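(* Let $\gamma$ be a specification on $(\Omega,\mathcal{F})$ that is monotonicity preserving and translation invariant, with associated specifications $\gamma^{(\pm)}$, measures $\mu^\pm$ and set $\Omega_\pm$. (a) If $h(\mu^-|\mu^+)=0$, then $\mu^-\in\mathcal{G}(\gamma^{(+)})$ and $\mu^-(\Omega_{\gamma^{(+)}})=\mu^-(\Omega_{\gamma^{(-)}})=1$ (hence $\mu^-$ is almost quasilocal). (b) If $\mu\in\mathcal{M}^+_{1,\mathrm{inv}}(\Omega)$ satisfies $h(\mu|\mu^+)=0$ and $\mu(\Omega_\pm)=1$, then $\mu\in\mathcal{G}(\gamma^{(+)})$, and thus $\mu$ is almost quasilocal. The analogous results with ''$+$'' and ''$-$'' interchanged also hold: if $h(\mu^+|\mu^-)=0$, then $\mu^+\in\mathcal{G}(\gamma^{(-)})$ and $\mu^+(\Omega_{\gamma^{(+)}})=\mu^+(\Omega_{\gamma^{(-)}})=1$ (hence $\mu^+$ is almost quasilocal); and if $\mu\in\mathcal{M}^+_{1,\mathrm{inv}}(\Omega)$ satisfies $h(\mu|\mu^-)=0$ and $\mu(\Omega_\pm)=1$, then $\mu\in\mathcal{G}(\gamma^{(-)})$, and thus $\mu$ is almost quasilocal.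
   Context: Configuration space: $\Omega=\Omega_0^{\mathbb{L}}$ with $\Omega_0$ finite and $\mathbb{L}$ countable (typically $\mathbb{L}=\mathbb{Z}^d$), with the product discrete topology and product Borel $\sigma$-algebra $\mathcal{F}$. $\mathcal{S}$ is the set of finite subsets of $\mathbb{L}$. For $\Lambda\subset\mathbb{L}$, $\Omega_\Lambda=\Omega_0^\Lambda$, $\omega_\Lambda$ is the restriction of $\omega$, $\omega_\Lambda\theta_{\Lambda^c}$ is the configuration equal to $\omega$ on $\Lambda$ and to $\theta$ off $\Lambda$, $\mathcal{F}_\Lambda$ is the $\sigma$-algebra generated by the coordinates in $\Lambda$, and $\mu_\Lambda$ is the projection of $\mu$ on $(\Omega_\Lambda,\mathcal{F}_\Lambda)$. A function is local if it depends on finitely many coordinates; $\mathcal{F}_{\mathrm{loc}}$ is the set of local functions. Translations: there is an action $\{\tau_i:i\in\mathbb{Z}^d\}$ on $\mathbb{L}$, inducing $(\tau_i\omega)_x=\omega_{\tau_{-i}x}$, $\tau_if(\omega)=f(\tau_{-i}\omega)$, $\tau_i\mu(f)=\mu(\tau_{-i}f)$, and on specifications $(\tau_i\gamma)_\Lambda(f|\omega)=\gamma_{\tau_{-i}\Lambda}(\tau_{-i}f|\tau_{-i}\omega)$. Translation invariance is invariance under all $\tau_i$. $\mathcal{M}^+_{1,\mathrm{inv}}(\Omega)$ is the set of translation-invariant probability measures. Cubes: $\Lambda_n=\{\tau_{-i}(0): i\in([-n,n]\cap\mathbb{Z})^d\}$. Specification: a family $\gamma=\{\gamma_\Lambda:\Lambda\in\mathcal{S}\}$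 of stochastic kernels, where $\gamma_\Lambda(A|\cdot)$ is $\mathcal{F}_{\Lambda^c}$-measurable for all $A\in\mathcal{F}$ and $\gamma_\Lambda(\cdot|\omega)$ is a probability measure on $(\Omega,\mathcal{F})$ for all $\omega$, that is proper ($\gamma_\Lambda(B|\omega)=\mathbf{1}_B(\omega)$ for $B\in\mathcal{F}_{\Lambda^c}$) and consistent ($\gamma_{\Lambda'}\gamma_\Lambda=\gamma_{\Lambda'}$ for finite $\Lambda\subset\Lambda'$). $\gamma_\Lambda f$ is the function $\omega\mapsto\gamma_\Lambda(f|\omega)=\int f\,d\gamma_\Lambda(\cdot|\omega)$. $\mathcal{G}(\gamma)$ is the set of probability measures $\mu$ with $\mu\gamma_\Lambda=\mu$ for all $\Lambda\in\mathcal{S}$. For a specification $\gamma$, $\Omega_\gamma$ is the set of configurations at which $\gamma_\Lambda f$ is continuous for all $\Lambda\in\mathcal{S}$ and all local $f$. A probability measure $\mu$ is almost quasilocal if it is consistent with some specification $\gamma$ (i.e. $\mu\in\mathcal{G}(\gamma)$) such that $\mu(\Omega_\gamma)=1$. Monotonicity: fix a total order on $\Omega_0$; it induces the partial order $\omega\le\sigma\iff\omega_x\le\sigma_x\ \forall x\in\mathbb{L}$ on $\Omega$, with maximal and minimal elements the constant configurations denoted ''$+$'' and ''$-$''. A specification $\gamma$ is monotonicity preserving if for each $\Lambda\in\mathcal{S}$, $\gamma_\Lambda f$ is increasing whenever $f$ is. For such $\gamma$ the following limits exist (a known fact): $\gamma^{(\pm)}_\Lambda(\cdot|\omega)=\lim_{S\uparrow\mathbb{L}}\gamma_\Lambda(\cdot|\omega_S\pm_{S^c})$,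 defining two monotonicity-preserving specifications $\gamma^{(+)}$ and $\gamma^{(-)}$ (translation-invariant if $\gamma$ is); and $\mu^\pm=\lim_{\Lambda\uparrow\mathbb{L}}\gamma_\Lambda(\cdot|\pm)$, defining two probability measures with $\mu^\pm\in\mathcal{G}(\gamma^{(\pm)})$ (translation-invariant if $\gamma$ is). Limits are along finite sets directed by inclusion, in the sense of convergence on local functions. Finally $$\Omega_\pm=\{\omega\in\Omega:\gamma^{(+)}_\Lambda(f|\omega)=\gamma^{(-)}_\Lambda(f|\omega)\ \ \forall f\in\mathcal{F}_{\mathrm{loc}},\ \forall\Lambda\in\mathcal{S}\}.$$ Relative entropy: for $\Lambda\in\mathcal{S}$, $H_\Lambda(\mu|\nu)=\int\frac{d\mu_\Lambda}{d\nu_\Lambda}\log\frac{d\mu_\Lambda}{d\nu_\Lambda}\,d\nu$ if $\mu_\Lambda\ll\nu_\Lambda$, $+\infty$ otherwise; $h(\mu|\nu)=\lim_{n\to\infty}H_{\Lambda_n}(\mu|\nu)/|\Lambda_n|$ (''$h(\mu|\nu)=0$'' means that the limit exists and equals $0$).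
   Formalization: The action of Z^d on L is assumed transitive, so that the cubes exhaust L (as for L = Z^d by translations); for a non-transitive action (b) is false: take a product specification and an invariant product measure that differs from μ^+ only off the orbit of 0. *)

(* Defs.v *)
From HB Require Import structures.
From mathcomp Require Import all_boot all_order all_algebra finmap.
From mathcomp Require Import all_classical all_reals all_analysis measurable_realfun.
From mathcomp Require summability.
From mathcomp Require Import zify.

Set Implicit Arguments.
Unset Strict Implicit.
Unset Printing Implicit Defensive.

Import Order.TTheory GRing.Theory Num.Theory numFieldNormedType.Exports.

Local Open Scope classical_set_scope.
Local Open Scope ring_scope.

(* The constant configurations "+" and "-" are [cst \top] and [cst \bot]. *)
Definition config (L : Type) (disp : Order.disp_t) (E : finTBOrderType disp) :
  Type := L -> E.

Section ConfigStructures.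
Context (L : Type) (disp : Order.disp_t) (E : finTBOrderType disp).

HB.instance Definition _ := Topological.copy (config L E)
  (prod_topology (fun _ : L => discrete_topology E)).

HB.instance Definition _ := isPointed.Build (config L E) (fun=> \bot%O).

Definition cylinders (D : set L) : set (set (config L E)) :=
  \bigcup_(x in D) [set (fun w : config L E => w x) @^-1` B | B in [set: set E]].

(* The sigma-algebra F_D; F itself, i.e. [measurable], is F_setT. *)
Definition sigma_coord (D : set L) : set (set (config L E)) :=
  <<s cylinders D >>.

Let sigma_coordT_C (A : set (config L E)) :
  sigma_coord setT A -> sigma_coord setT (~` A).
Proof. exact: sigma_algebraC. Qed.

HB.instance Definition _ := @isMeasurable.Build
  (sigma_display (cylinders setT)) (config L E) (sigma_coord setT)
  (@sigma_algebra0 _ setT _) sigma_coordT_C (@sigma_algebra_bigcup _ setT _).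

End ConfigStructures.

Section Configurations.
Context (L : choiceType) (disp : Order.disp_t) (E : finTBOrderType disp).
Implicit Types (w s t : config L E) (Lam S : {fset L}).

(* w_S t_{S^c} *)
Definition splice S w t : config L E := fun x => if x \in S then w x else t x.

Definition restr Lam w : config Lam E := fun x => w (val x).
Arguments restr : clear implicits.

Lemma measurable_restr Lam : measurable_fun setT (restr Lam).
Proof.
apply: (@measurability _ _ _ _ setT (restr Lam) (cylinders setT)) => //.
move=> _ [_ [x _ [B _ <-]] <-]; rewrite setTI.
by apply: sub_sigma_algebra; exists (val x) => //; exists B.
Qed.

HB.instance Definition _ Lam :=
  isMeasurableFun.Build _ _ _ _ (restr Lam) (@measurable_restr Lam).

Definition local_fun (T : Type) (f : config L E -> T) : Prop :=
  exists Lam, forall w s, (forall x, x \in Lam -> w x = s x) -> f w = f s.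

Definition config_le w s : Prop := forall x, (w x <= s x)%O.

Definition increasing (R : realType) (f : config L E -> R) : Prop :=
  forall w s, config_le w s -> f w <= f s.

End Configurations.

Arguments restr {L disp E} Lam w.

Section Specifications.
Context (R : realType) (L : choiceType) (disp : Order.disp_t)
  (E : finTBOrderType disp).
Notation Omega := (config L E).
Implicit Types (Lam V : {fset L}) (w th : Omega) (A B : set Omega)
  (f : Omega -> R) (mu nu : probability Omega R).

(* g Lam w is the probability measure gamma_Lam( . | w). *)
Definition kernel_family := {fset L} -> Omega -> probability Omega R.
Implicit Types g gp gm : kernel_family.

Definition kapp g Lam f : Omega -> R := fun w => \int[g Lam w]_s f s.

Record is_specification g : Prop := IsSpecification {
  spec_measurable : forall Lam A, measurable A ->
    forall Y : set (\bar R), measurable Y ->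
      sigma_coord (~` [set` Lam]) ((fun w => g Lam w A) @^-1` Y);
  spec_proper : forall Lam B w, sigma_coord (~` [set` Lam]) B ->
    g Lam w B = (\1_B w)%:E;
  spec_consistent : forall Lam V, (Lam `<=` V)%fset ->
    forall w A, measurable A -> (\int[g V w]_s g Lam s A = g V w A)%E }.

Definition gibbs g mu : Prop :=
  forall Lam A, measurable A -> (\int[mu]_w g Lam w A = mu A)%E.

Definition continuity_set g : set Omega :=
  [set w | forall Lam f, local_fun f -> {for w, continuous (kapp g Lam f)}].

Definition almost_quasilocal mu : Prop :=
  exists g, [/\ is_specification g, gibbs g mu & mu (continuity_set g) = 1%E].

(* An increasing f is automatically bounded, so that gamma_Lam f makes sense  *)
(* as soon as f is measurable. *)
Definition monotonicity_preserving g : Prop :=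
  forall Lam f, measurable_fun setT f -> increasing f -> increasing (kapp g Lam f).

(* gth is the limit of gamma_Lam( . | w_S th_{S^c}) as S increases to L. *)
Definition boundary_limit g th gth : Prop :=
  forall Lam w f, local_fun f ->
    kapp g Lam f (splice S w th) @[S --> summability.totally]
      --> kapp gth Lam f w.

(* mu is the limit of gamma_V( . | th) as V increases to L. *)
Definition volume_limit g th mu : Prop :=
  forall f, local_fun f ->
    kapp g V f th @[V --> summability.totally] --> (\int[mu]_s f s : R).

Definition Omega_pm gp gm : set Omega :=
  [set w | forall Lam f, local_fun f -> kapp gp Lam f w = kapp gm Lam f w].

Definition marginal mu Lam : probability (config Lam E) R :=
  distribution mu (@restr L disp E Lam).

Definition rel_entropy Lam mu nu : \bar R :=
  if `[< marginal mu Lam `<< marginal nu Lam >] then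
    (\int[nu]_w
      let r := fine (Radon_Nikodym
        (charge_of_finite_measure (marginal mu Lam)) (marginal nu Lam)
        (restr Lam w)) in
      (r * ln r)%:E)%E
  else +oo%E.

End Specifications.

Section Translations.
Context (d : nat) (L : choiceType) (act : 'rV[int]_d -> L -> L).

(* Transitivity says exactly that the cubes below exhaust L; otherwise a zero *)
(* relative entropy density gives no information off the orbit of the origin. *)
Record transitive_action : Prop := TransitiveAction {
  act0 : forall x, act 0 x = x;
  actD : forall i j x, act (i + j) x = act i (act j x);
  act_trans : forall x y, exists i, act i x = y }.

Definition cube (o : L) (n : nat) : {fset L} :=
  [fset act (- \row_(j < d) ((k j)%:Z - n%:Z)) o
     | k : {ffun 'I_d -> 'I_(n.*2.+1)} in predT]%fset.

Lemma in_cube o n x :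
  x \in cube o n <->
  exists2 i : 'rV[int]_d, (forall j, `|i 0 j| <= n%:Z) & x = act (- i) o.
Proof.
split=> [/imfsetP[k _ ->]|[i ile ->]].
  exists (\row_(j < d) ((k j)%:Z - n%:Z)) => // j; rewrite mxE.
  by have := ltn_ord (k j); lia.
pose k := [ffun j : 'I_d => inord (absz (i 0 j + n%:Z)) : 'I_(n.*2.+1)].
apply/imfsetP; exists k => //; congr (act (- _) o); apply/rowP => j.
rewrite mxE ffunE; move: (ile j); move: (i 0 j) => {k ile x i}a aP.
rewrite inordK; lia.
Qed.

Context (R : realType) (disp : Order.disp_t) (E : finTBOrderType disp).
Notation Omega := (config L E).

Definition translate (i : 'rV[int]_d) (w : Omega) : Omega :=
  fun x => w (act (- i) x).

Definition invariant_measure (mu : probability Omega R) : Prop :=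
  forall i (A : set Omega), measurable A -> mu (translate i @^-1` A) = mu A.

(* (tau_i gamma)_Lam(A|w) = gamma_{tau_{-i} Lam}(tau_i^{-1} A | tau_{-i} w) *)
Definition invariant_spec (g : kernel_family R L E) : Prop :=
  forall i Lam w (A : set Omega), measurable A ->
    g [fset act (- i) x | x in Lam]%fset (translate (- i) w)
      (translate i @^-1` A) = g Lam w A.

Definition zero_entropy_density (o : L) (mu nu : probability Omega R) : Prop :=
  (rel_entropy (cube o n) mu nu * (#|` cube o n|%:R^-1)%:E)%E
    @[n --> \oo] --> 0%E.

End Translations.

(* Main.v *)
From mathcomp Require Import all_boot all_order all_algebra finmap.
From mathcomp Require Import all_classical all_reals all_analysis measurable_realfun.
From mathcomp Require summability.
From mathcomp Require Import zify ring lra.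
Require Import Defs.

(** Write [g] for the specification, [g+] and [g-] for its limits with extreme
    boundary conditions, [m+] and [m-] for the limit measures. For an increasing
    local function [f], the functions [w |-> g_Lam(f | w_S +)] are local and
    decrease to [g+_Lam f] as [S] grows, while the functions
    [w |-> g_Lam(f | w_S -)] increase to [g-_Lam f]; every local function is a
    difference of increasing ones ([local_monotone_sub]). Where [g+] and [g-]
    agree, both are therefore continuous ([Omega_pm_continuity]), and everything
    reduces to showing that a measure [mu] of zero entropy density gives
    [g+_Lam f], [g-_Lam f] and [f] the same average.

    Zero entropy density is used as follows. The relative entropy of [mu] with
    respect to [nu] on a cube is at least the sum of the losses of entropy when
    disjoint translates of [Lam] are removed from the cube one after the other.
    As there are proportionally many of them, one loss is small, and by
    translation invariance it may be attached to [Lam] itself, inside an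
    arbitrarily large volume [W] ([small_entropy_gap]). By a Pinsker-type
    estimate ([entropy_estimate]), [mu f] is then close to [nu (v f)], where [v]
    is the density of [mu] with respect to [nu] on [D], the complement of [Lam]
    in [W] ([density_approx]).

    If [nu] is a limit of finite volume kernels, the spins in [Lam] may be
    resampled under [nu (v f)], as [v] is nonnegative and does not depend on
    them, and freezing the spins off [S] at + raises the result:
    [nu (v f) <= nu (v g_Lam(f | ._S +)) = mu (g_Lam(f | ._S +))]. Hence
    [mu f <= mu (g+_Lam f)] and, symmetrically, [mu (g-_Lam f) <= mu f]
    ([avg_le_limit]). If [mu] is carried by the set where [g+] and [g-] agree,
    these are equalities and [mu] is Gibbs for both ([Omega_pm_gibbs]).

    For [mu = m-] and [nu = m+] that set has full measure. Indeed, given the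
    spins in [D], the measure [m+] dominates [m-] ([cyl_domination]), and
    therefore [nu (v h) >= mu h] for increasing [h]. With
    [h = g_Lam(f | ._S +)] and [S] growing, [nu (v h)] tends to [nu (v f)], which
    is close to [mu f]: thus [mu (g+_Lam f) <= mu f] ([limit_le_avg]). Since
    [m-] is Gibbs for [g-], also [mu f = mu (g-_Lam f) <= mu (g+_Lam f)], so that
    [g+_Lam f] and [g-_Lam f], which are ordered, agree almost surely
    ([opposite_Omega_pm]).

    That [g+] is a specification and that [m+] is Gibbs for it are two instances
    of one squeezing argument ([frozen_cvg]), about measures that approximate
    [nu] and are carried by configurations frozen off [S].

    The exchange of + and - is a boolean parameter [b] throughout. *)

Set Implicit Arguments.
Unset Strict Implicit.
Unset Printing Implicit Defensive.

Import Order.TTheory GRing.Theory Num.Theory numFieldNormedType.Exports.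

Local Open Scope classical_set_scope.
Local Open Scope ring_scope.

#[local] Existing Instance summability.totally_filter.

(** * Cylinders and local functions *)

Section Local.
Context (L : choiceType) (disp : Order.disp_t) (E : finTBOrderType disp).
Notation Omega := (config L E).
Implicit Types (S T V : {fset L}) (w s t : Omega).

Definition cyl S w : set Omega := [set s | forall x, x \in S -> s x = w x].

Definition depends_on (T : Type) (D : set L) (f : Omega -> T) : Prop :=
  forall w s, (forall x, D x -> w x = s x) -> f w = f s.

Definition pattern S := {ffun S -> E}.

Definition extend S (p : pattern S) : Omega :=
  fun x => if insub x is Some u then p u else \bot%O.

Definition observe S w : pattern S := [ffun u => w (val u)].

Lemma extendE S (p : pattern S) (u : S) : extend p (val u) = p u.
Proof. by rewrite /extend valK. Qed.

Lemma extend_observe S w x : x \in S -> extend (observe S w) x = w x.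
Proof. by move=> xS; rewrite /extend insubT ffunE. Qed.

Lemma cyl_extend S (p : pattern S) w : cyl S (extend p) w <-> observe S w = p.
Proof.
split=> [h|<- x xS]; last by rewrite extend_observe.
by apply/ffunP => u; rewrite ffunE h ?extendE ?fsvalP.
Qed.

Lemma dependsS (T : Type) (D D' : set L) (f : Omega -> T) :
  D `<=` D' -> depends_on D f -> depends_on D' f.
Proof. by move=> DD df w s ws; apply: df => x /DD; apply: ws. Qed.

Lemma depends_local (T : Type) S (f : Omega -> T) :
  depends_on [set` S] f -> local_fun f.
Proof. by move=> df; exists S. Qed.

Lemma depends_comp (D : set L) (T U : Type) (F : T -> U) (f : Omega -> T) :
  depends_on D f -> depends_on D (F \o f).
Proof. by move=> df w s /df /= ->. Qed.

Lemma depends_comp2 (D : set L) (T U V : Type) (F : T -> U -> V)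
    (f : Omega -> T) (g : Omega -> U) :
  depends_on D f -> depends_on D g -> depends_on D (fun w => F (f w) (g w)).
Proof. by move=> df dg w s h; rewrite (df _ _ h) (dg _ _ h). Qed.

Lemma local_comp2 (T U V : Type) (F : T -> U -> V)
    (f : Omega -> T) (g : Omega -> U) :
  local_fun f -> local_fun g -> local_fun (fun w => F (f w) (g w)).
Proof.
move=> [S dS] [T' dT]; exists (S `|` T')%fset => w s h.
by rewrite (dS w s) ?(dT w s) // => x xS; apply: h; rewrite inE xS ?orbT.
Qed.

Lemma local_comp (T U : Type) (F : T -> U) (f : Omega -> T) :
  local_fun f -> local_fun (F \o f).
Proof. by move=> [S dS]; exists S => w s /dS /= ->. Qed.

(** Every configuration shows exactly one pattern on [S]. This is what turns
    integrals of local functions into finite sums. *)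
Lemma depends_sum (R : nzRingType) S (f : Omega -> R) w :
  depends_on [set` S] f ->
  f w = \sum_(p : pattern S) f (extend p) * \1_(cyl S (extend p)) w.
Proof.
move=> df; rewrite (bigD1 (observe S w)) //= big1 ?addr0.
  rewrite indicE mem_set ?mulr1; last by apply/cyl_extend.
  by apply: df => x /= xS; rewrite extend_observe.
move=> p /eqP pw; rewrite indicE memNset ?mulr0 //.
by move=> /cyl_extend /esym.
Qed.

Lemma depends_cyl (R : nzRingType) S w :
  depends_on [set` S] (\1_(cyl S w) : Omega -> R).
Proof.
move=> s t st; rewrite !indicE; congr ((_ : bool)%:R).
by apply/idP/idP; rewrite !inE => h x xS; rewrite -h// st.
Qed.

Lemma local_cyl (R : nzRingType) S w : local_fun (\1_(cyl S w) : Omega -> R).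
Proof. exact: depends_local (@depends_cyl R S w). Qed.

Lemma cylS S T w : (S `<=` T)%fset -> cyl T w `<=` cyl S w.
Proof. by move=> /fsubsetP ST s h x /ST; apply: h. Qed.

Lemma eq_cyl S w s : cyl S w s -> cyl S s = cyl S w.
Proof.
by move=> h; apply/seteqP; split=> t ht x xS; rewrite ht ?h.
Qed.


Lemma cyl_bigcap S w :
  cyl S w = \bigcap_(x in [set` S]) ((fun s : Omega => s x) @^-1` [set w x]).
Proof. by apply/seteqP; split=> s h x xS; apply: h. Qed.

Lemma sigma_coord_cyl (D : set L) S w :
  [set` S] `<=` D -> sigma_coord D (cyl S w).
Proof.
move=> SD; rewrite cyl_bigcap.
apply: (@fin_bigcap_measurable _ (g_sigma_algebraType (cylinders D))).
  exact: finite_fset.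
by move=> x /SD Dx; apply: sub_sigma_algebra; exists x => //; exists [set w x].
Qed.

Lemma sigma_coordS (D D' : set L) (A : set Omega) :
  D `<=` D' -> sigma_coord D A -> sigma_coord D' A.
Proof.
move=> DD; apply: sub_smallest2r; first exact: smallest_sigma_algebra.
by move=> B [x /DD ? ?]; exists x.
Qed.

Lemma sigma_coord_measurable (D : set L) (A : set Omega) :
  sigma_coord D A -> measurable A.
Proof. exact: sigma_coordS. Qed.

Lemma measurable_cyl S w : measurable (cyl S w).
Proof. exact: sigma_coord_measurable (@sigma_coord_cyl setT _ _ _). Qed.

(** The sets that do not separate configurations equal on [D] form a
    sigma-algebra. *)
Lemma sigma_coord_depends (D : set L) (A : set Omega) :
  sigma_coord D A -> depends_on D A.
Proof.
move=> sA w s ws; apply/propext; move: A sA.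
suff : sigma_coord D `<=` [set A | A w <-> A s] by [].
apply: smallest_sub; last first.
  by move=> _ [x Dx [B _ <-]] /=; rewrite ws.
split=> // [A|F h]; first by rewrite setTD /= /setC /= => ->.
by split=> -[i _ /h Fi]; exists i.
Qed.

Lemma cylI S T w s : cyl S w `&` cyl T s = set0 \/
  exists t, cyl S w `&` cyl T s = cyl (S `|` T)%fset t.
Proof.
have [->|/set0P[t [wt st]]] := eqVneq (cyl S w `&` cyl T s) set0; first by left.
right; exists t; rewrite -(eq_cyl wt) -(eq_cyl st).
apply/seteqP; split=> [u [h1 h2] x|u h].
  by rewrite inE => /orP[/h1|/h2].
by split=> x xS; apply: h; rewrite inE xS ?orbT.
Qed.

(** The pi-lambda theorem: together with the empty set, the cylinders on finite
    parts of [D] are stable under intersection and generate F_D. *)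
Lemma sigma_coord_ind (D : set L) (P : set Omega -> Prop) :
  P set0 ->
  (forall S w, [set` S] `<=` D -> P (cyl S w)) ->
  (forall A, sigma_coord D A -> P A -> P (~` A)) ->
  (forall F : (set Omega)^nat, (forall n, sigma_coord D (F n)) ->
     trivIset setT F -> (forall n, P (F n)) -> P (\bigcup_n F n)) ->
  forall A, sigma_coord D A -> P A.
Proof.
move=> P0 Pcyl PC PU.
pose G := [set A : set Omega | A = set0 \/
  exists S w, [set` S] `<=` D /\ A = cyl S w].
have GI : setI_closed G.
  move=> A B [->|[S [w [SD ->]]]]; first by rewrite set0I; left.
  move=> [->|[T [s [TD ->]]]]; first by rewrite setI0; left.
  have [->|[t ->]] := cylI S T w s; [by left|right].
  exists (S `|` T)%fset, t; split=> // x /=; rewrite inE => /orP[].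
    exact: SD.
  exact: TD.
have GD : G `<=` sigma_coord D.
  by move=> A [->|[S [w [SD ->]]]]; [exact: sigma_algebra0|exact: sigma_coord_cyl].
have DG : sigma_coord D `<=` <<s G >>.
  apply: smallest_sub; first exact: smallest_sigma_algebra.
  move=> _ [x Dx [B _ <-]].
  have -> : (fun w : Omega => w x) @^-1` B =
      \bigcup_(e in B) cyl [fset x]%fset (fun=> e).
    apply/seteqP; split=> [w Bw|w [e Be /(_ x)]] /=.
      by exists (w x) => // y; rewrite inE => /eqP ->.
    by rewrite inE eqxx => ->.
  apply: (@fin_bigcup_measurable _ (g_sigma_algebraType G)) => // e Be.
  apply: sub_sigma_algebra; right; exists [fset x]%fset, (fun=> e); split=> //.
  by move=> y /=; rewrite inE => /eqP ->.
move=> A /DG; suff /[apply] -[] : <<s G >> `<=` [set A | sigma_coord D A /\ P A].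
  by [].
apply: lambda_system_subset => //; last first.
  by move=> B GB; split; [exact: GD|case: GB => [->//|[S [w [SD ->]]]]; exact: Pcyl].
apply/dynkin_lambda_system; split.
- split; first exact: (@measurableT _ (g_sigma_algebraType (cylinders D))).
  by rewrite -setC0; apply: PC => //; exact: sigma_algebra0.
- move=> B [mB PB]; split; last exact: PC.
  exact: (@measurableC _ (g_sigma_algebraType (cylinders D))).
- move=> F tF h; split; last by apply: PU => // n; have [] := h n.
  apply: sigma_algebra_bigcup => n; first by have [] := h n.
Qed.

Lemma nbhs_cyl S w : nbhs w (cyl S w).
Proof.
rewrite cyl_bigcap; apply: filter_bigI => x xS.
have := @proj_continuous L (fun=> discrete_topology E) x w.
apply; rewrite nbhs_principalE; exact/principal_filterP.
Qed.

(** The filter generated by the cylinders around [w] converges to [w] coordinate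
    by coordinate, hence in the product topology. *)
Lemma cyl_nbhs w (A : set Omega) : nbhs w A -> exists S, cyl S w `<=` A.
Proof.
pose F := filter_from [set: {fset L}] (fun S => cyl S w).
have FF : Filter F.
  apply: filter_fromT_filter; first by exists fset0.
  move=> S T; exists (S `|` T)%fset => s h.
  by split=> x xS; apply: h; rewrite inE xS ?orbT.
suff cF : F --> w by move=> /cF [S _ SA]; exists S.
apply/cvg_sup => x; rewrite /cvg_to /= => B [_ [[C oC <-] Cw CB]].
exists [fset x]%fset => // s sw; apply: CB => /=.
by rewrite sw // inE.
Qed.

End Local.

(** * Expectations of bounded measurable functions *)

Section Expectation.
Context (R : realType) (d : measure_display) (T : measurableType d).
Implicit Types (f g : T -> R) (mu : probability T R).

(** For a probability measure this class consists of integrable functions and,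
    unlike integrability, it is stable under products. *)
Definition bounded_measurable f : Prop :=
  measurable_fun setT f /\ exists M, forall x, `|f x| <= M.

Lemma bm_integrable mu f : bounded_measurable f -> mu.-integrable setT (EFin \o f).
Proof.
move=> [mf [M fM]]; apply: measurable_bounded_integrable => //.
  by rewrite (le_lt_trans (probability_le1 _ _)) // ltry.
exists M; split; first exact: num_real.
by move=> N MN x _; apply: (le_trans (fM x)); apply: ltW.
Qed.

Lemma bm_cst (c : R) : bounded_measurable (fun=> c).
Proof. by split; [exact: measurable_cst|exists `|c|]. Qed.

Lemma bm_add f g : bounded_measurable f -> bounded_measurable g ->
  bounded_measurable (fun x => f x + g x).
Proof.
move=> [mf [M fM]] [mg [N gN]]; split; first exact: measurable_funD.
by exists (M + N) => x; rewrite (le_trans (ler_normD _ _)) // lerD.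
Qed.

Lemma bm_mul f g : bounded_measurable f -> bounded_measurable g ->
  bounded_measurable (fun x => f x * g x).
Proof.
move=> [mf [M fM]] [mg [N gN]]; split; first exact: measurable_funM.
by exists (M * N) => x; rewrite normrM ler_pM.
Qed.

Lemma bm_opp f : bounded_measurable f -> bounded_measurable (fun x => - f x).
Proof.
move=> [mf [M fM]]; split; first exact: measurableT_comp.
by exists M => x; rewrite normrN.
Qed.

Lemma bm_sub f g : bounded_measurable f -> bounded_measurable g ->
  bounded_measurable (fun x => f x - g x).
Proof. by move=> bf bg; apply: bm_add => //; apply: bm_opp. Qed.

Lemma bm_sum (I : Type) (r : seq I) (F : I -> T -> R) :
  (forall i, bounded_measurable (F i)) ->
  bounded_measurable (fun x => \sum_(i <- r) F i x).
Proof.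
move=> bF; elim: r => [|i r IH].
  rewrite (_ : (fun=> _) = fun=> 0); first exact: bm_cst.
  by apply/funext => x; rewrite big_nil.
rewrite (_ : (fun=> _) = fun x => F i x + \sum_(i <- r) F i x).
  exact: bm_add.
by apply/funext => x; rewrite big_cons.
Qed.

Lemma bm_indic (A : set T) : measurable A -> bounded_measurable (\1_A : T -> R).
Proof.
move=> mA; split; first exact: measurable_indic.
by exists 1 => x; rewrite indicE; case: (_ \in _); rewrite ?normr0 ?normr1.
Qed.

Lemma avg_add mu f g : bounded_measurable f -> bounded_measurable g ->
  \int[mu]_x (f x + g x) = \int[mu]_x f x + \int[mu]_x g x.
Proof. by move=> bf bg; apply: RintegralD => //; apply: bm_integrable. Qed.

Lemma avg_sub mu f g : bounded_measurable f -> bounded_measurable g ->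
  \int[mu]_x (f x - g x) = \int[mu]_x f x - \int[mu]_x g x.
Proof. by move=> bf bg; apply: RintegralB => //; apply: bm_integrable. Qed.

Lemma avg_scale mu (c : R) f : bounded_measurable f ->
  \int[mu]_x (c * f x) = c * \int[mu]_x f x.
Proof. by move=> bf; apply: RintegralZl => //; apply: bm_integrable. Qed.

Lemma avg_cst mu (c : R) : \int[mu]_x c = c.
Proof.
rewrite Rintegral_cst // (_ : fine _ = 1) ?mulr1 //.
by rewrite -[RHS]/(fine 1%E); congr fine; exact: probability_setT.
Qed.

Lemma avg_opp mu f : bounded_measurable f ->
  \int[mu]_x (- f x) = - \int[mu]_x f x.
Proof.
move=> bf; rewrite -mulN1r -avg_scale //.
by apply: eq_Rintegral => x _; rewrite mulN1r.
Qed.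

Lemma avg_le mu f g : bounded_measurable f -> bounded_measurable g ->
  (forall x, f x <= g x) -> \int[mu]_x f x <= \int[mu]_x g x.
Proof.
by move=> bf bg fg; apply: le_Rintegral => //; exact: bm_integrable.
Qed.

Lemma avg_sum mu (I : Type) (r : seq I) (F : I -> T -> R) :
  (forall i, bounded_measurable (F i)) ->
  \int[mu]_x (\sum_(i <- r) F i x) = \sum_(i <- r) \int[mu]_x F i x.
Proof.
move=> bF; elim: r => [|i r IH].
  rewrite big_nil -[RHS](avg_cst mu); apply: eq_Rintegral => x _.
  by rewrite big_nil.
rewrite big_cons -IH -avg_add //; last exact: bm_sum.
by apply: eq_Rintegral => x _; rewrite big_cons.
Qed.

Lemma avg_indic mu (A : set T) : measurable A -> \int[mu]_x (\1_A x) = fine (mu A).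
Proof. by move=> mA; rewrite /Rintegral integral_indic // setIT. Qed.

Lemma avg_EFin mu f : bounded_measurable f ->
  (\int[mu]_x (f x)%:E)%E = (\int[mu]_x f x)%:E.
Proof.
by move=> bf; rewrite fineK //; apply/integrable_fin_num/bm_integrable.
Qed.

Lemma avg_norm mu f (M : R) : bounded_measurable f -> (forall x, `|f x| <= M) ->
  `|\int[mu]_x f x| <= M.
Proof.
move=> bf fM; rewrite ler_norml -{2}(avg_cst mu M) -(avg_cst mu (- M)).
by rewrite !avg_le //; try exact: bm_cst; move=> x;
  have := fM x; rewrite ler_norml => /andP[].
Qed.

Lemma avg_ae mu (Z : set T) f g : measurable Z -> mu Z = 1%E ->
  bounded_measurable f -> bounded_measurable g ->
  (forall x, Z x -> f x = g x) -> \int[mu]_x f x = \int[mu]_x g x.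
Proof.
move=> mZ Z1 [mf _] [mg _] fg; congr fine; apply: ae_eq_integral => //.
- exact/measurable_EFinP.
- exact/measurable_EFinP.
exists (~` Z); split; first exact: measurableC.
  have h : mu (~` Z) = 0%E by rewrite probability_setC // Z1 subee.
  exact: h.
by move=> x /= h Zx; apply: h => _; rewrite fg.
Qed.

(** Applied to the difference of two ordered functions with the same integral,
    this yields their equality almost everywhere. *)
Lemma avg_eq0 mu f : bounded_measurable f -> (forall x, 0 <= f x) ->
  \int[mu]_x f x = 0 -> mu [set x | f x = 0] = 1%E.
Proof.
move=> bf f0 If; have [mf _] := bf.
have mZ : measurable [set x | f x = 0].
  by rewrite -[X in measurable X]setTI; exact: (mf measurableT [set 0]).
have : ae_eq mu setT (EFin \o f) (cst 0%E).
  apply/ae_eq_integral_abs => //; first exact/measurable_EFinP.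
  under eq_integral do rewrite /= ger0_norm //.
  by rewrite avg_EFin // If.
move=> [N [mN N0 hN]].
have : mu (~` [set x | f x = 0]) = 0%E.
  apply: (subset_measure0 _ _ _ N0) => //; first exact: measurableC.
  apply: subset_trans hN => x /= fx h; apply: fx.
  by have [] := h I.
rewrite probability_setC // => /eqP; rewrite sube_eq //.
by rewrite add0e => /eqP ->.
Qed.

Lemma prob_fin mu (A : set T) : measurable A -> mu A = (fine (mu A))%:E.
Proof.
move=> mA; rewrite fineK // ge0_fin_numE //.
by rewrite (le_lt_trans (probability_le1 _ _)) // ltry.
Qed.

End Expectation.

(** * Integrals of local functions *)

Section LocalMeasurable.
Context (R : realType) (L : choiceType) (disp : Order.disp_t)
  (E : finTBOrderType disp).
Notation Omega := (config L E).
Implicit Types (S T V : {fset L}) (w s t : Omega) (mu nu : probability Omega R).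

Lemma depends_measurable (D : set L) S (f : Omega -> R) :
  [set` S] `<=` D -> depends_on [set` S] f ->
  measurable_fun (setT : set (g_sigma_algebraType (@cylinders L disp E D))) f.
Proof.
move=> SD df.
rewrite (_ : f = fun w => \sum_(p : pattern E S)
                   f (extend p) * \1_(cyl S (extend p)) w); last first.
  by apply/funext => w; apply: depends_sum.
apply: measurable_sum => p; apply: measurable_funM => //.
by apply: measurable_indic; exact: sigma_coord_cyl.
Qed.

Lemma local_bm (f : Omega -> R) : local_fun f -> bounded_measurable f.
Proof.
move=> [S df]; split; first exact: (@depends_measurable setT S).
exists (\sum_(p : pattern E S) `|f (extend p)|) => w.
rewrite (_ : f w = f (extend (observe S w))); last first.
  by apply: df => x xS; rewrite extend_observe.
by rewrite (bigD1 (observe S w)) //= lerDl sumr_ge0.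
Qed.

Lemma bm_cyl S w : bounded_measurable (\1_(cyl S w) : Omega -> R).
Proof. by apply: bm_indic; exact: measurable_cyl. Qed.

(** Conditioning on the finitely many patterns in [S], without dividing by their
    probabilities. *)
Lemma avg_depends mu S (v h : Omega -> R) :
  depends_on [set` S] v -> bounded_measurable h ->
  \int[mu]_s (v s * h s) = \sum_(p : pattern E S)
    v (extend p) * \int[mu]_s (\1_(cyl S (extend p)) s * h s).
Proof.
move=> dv bh; have bc p : bounded_measurable
    (fun s => \1_(cyl S (@extend L disp E S p)) s * h s).
  by apply: bm_mul => //; exact: bm_cyl.
under [RHS]eq_bigr => p _ do rewrite -avg_scale //.
rewrite -avg_sum; last by move=> p; apply: bm_mul => //; exact: bm_cst.
apply: eq_Rintegral => s _; rewrite (depends_sum s dv) big_distrl /=.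
by apply: eq_bigr => p _; rewrite mulrA.
Qed.

Lemma avg_depends1 mu S (v : Omega -> R) :
  depends_on [set` S] v ->
  \int[mu]_s v s = \sum_(p : pattern E S)
    v (extend p) * fine (mu (cyl S (extend p))).
Proof.
move=> dv; transitivity (\int[mu]_s (v s * 1)).
  by apply: eq_Rintegral => s _; rewrite mulr1.
rewrite (avg_depends _ dv); last exact: bm_cst.
apply: eq_bigr => p _; congr (_ * _); rewrite -avg_indic; last exact: measurable_cyl.
by apply: eq_Rintegral => s _; rewrite mulr1.
Qed.

Lemma avg_cyl mu S w : \int[mu]_s (\1_(cyl S w) s) = fine (mu (cyl S w)).
Proof. by rewrite avg_indic //; exact: measurable_cyl. Qed.

(** The sets on which the mixture of the [k w] under [mu] agrees with [nu] form a
    lambda-system. Both the Gibbs property and the consistency of a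
    specification are equalities of this kind, so that they only have to be
    proved for local functions. *)
Lemma mixture_eq (k : Omega -> probability Omega R) mu nu :
  (forall A, measurable A -> measurable_fun setT (fun w => k w A)) ->
  (forall f : Omega -> R, local_fun f ->
    \int[mu]_w (\int[k w]_s f s) = \int[nu]_s f s) ->
  forall A, measurable A -> (\int[mu]_w k w A = nu A)%E.
Proof.
move=> mk kf.
apply: sigma_coord_ind => [|S w _|A mA IH|F mF tF IH].
- under eq_integral do rewrite measure0.
  by rewrite integral0 measure0.
- have mC := @measurable_cyl L disp E S w.
  have := kf _ (@local_cyl L disp E R S w); rewrite avg_cyl => h.
  rewrite [RHS](prob_fin _ mC) -h -avg_EFin.
    by apply: eq_integral => s _; rewrite avg_cyl [LHS](prob_fin _ mC).
  split; last first.
    exists 1 => s; rewrite avg_cyl ger0_norm ?fine_ge0 //.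
    by rewrite -lee_fin -prob_fin // probability_le1.
  apply/measurable_EFinP.
  rewrite (_ : EFin \o _ = fun s => k s (cyl S w)); first exact: mk.
  by apply/funext => s /=; rewrite avg_cyl -prob_fin.
- have mA' : measurable A by [].
  rewrite probability_setC // -IH.
  under eq_integral do rewrite probability_setC //.
  rewrite integralB //.
  + rewrite integral_cst //= mul1e; congr (_ - _)%E; exact: probability_setT.
  + apply/integrableP; split; first exact: measurable_cst.
    under eq_integral do rewrite abse1.
    rewrite integral_cst // mul1e.
    by rewrite (le_lt_trans (probability_le1 _ _)) // ltry.
  + apply/integrableP; split; first exact: mk.
    under eq_integral do rewrite gee0_abs //.
    rewrite IH.
    by rewrite (le_lt_trans (probability_le1 _ _)) // ltry.
- have mF' n : measurable (F n) by exact: mF.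
  rewrite measure_semi_bigcup //; last exact: bigcupT_measurable.
  under eq_integral.
    move=> s _; rewrite measure_semi_bigcup //; last exact: bigcupT_measurable.
    over.
  rewrite integral_nneseries //; last by move=> n; exact: mk.
  by apply: eq_eseriesr => n _; apply: IH.
Qed.

Lemma avg_prob_eq mu nu : (forall A, measurable A -> mu A = nu A) ->
  forall f : Omega -> R, \int[mu]_s f s = \int[nu]_s f s.
Proof.
by move=> h f; congr fine; apply: eq_measure_integral => A mA _; exact: h.
Qed.

End LocalMeasurable.

(** * Kernels of a specification *)

Lemma countable_bigcapT_measurable d (T : measurableType d) (U : countType)
    (F : U -> set T) :
  (forall i, measurable (F i)) -> measurable (\bigcap_i F i).
Proof.
move=> mF; rewrite -[X in measurable X]setCK setC_bigcap; apply: measurableC.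
by apply: countable_bigcupT_measurable => // i; apply: measurableC.
Qed.

Section Specification.
Context (R : realType) (L : countType) (disp : Order.disp_t)
  (E : finTBOrderType disp).
Notation Omega := (config L E).
Implicit Types (S T V Lam : {fset L}) (w s t th : Omega)
  (mu nu : probability Omega R) (f h v : Omega -> R).

Lemma splice_in S w th x : x \in S -> splice S w th x = w x.
Proof. by rewrite /splice => ->. Qed.

Lemma splice_out S w th x : x \notin S -> splice S w th x = th x.
Proof. by rewrite /splice => /negbTE ->. Qed.

Lemma depends_splice (U : Type) S th (f : Omega -> U) :
  depends_on [set` S] (fun w => f (splice S w th)).
Proof.
move=> w s ws; congr f; apply/funext => x; rewrite /splice.
by case: ifP => // xS; apply: ws.
Qed.

Lemma local_splice (U : Type) S th (f : Omega -> U) :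
  local_fun (fun w => f (splice S w th)).
Proof. exact: depends_local (@depends_splice U S th f). Qed.

Definition off_set V w : set Omega := [set s | forall x, x \notin V -> s x = w x].

Lemma sigma_coord_off V w : sigma_coord (~` [set` V]) (off_set V w).
Proof.
have -> : off_set V w = \bigcap_(x in [set: L])
    (if x \in V then setT else (fun s : Omega => s x) @^-1` [set w x]).
  apply/seteqP; split=> s h x; first by move=> _; case: ifPn => // xV; apply: h.
  by move=> /negbTE xV; have := h x I; rewrite xV.
apply: (@countable_bigcapT_measurable _
  (g_sigma_algebraType (cylinders (~` [set` V])))) => x.
case: ifPn => xV; first exact: measurableT.
apply: sub_sigma_algebra; exists x; first exact/negP.
by exists [set w x].
Qed.

Lemma measurable_off V w : measurable (off_set V w).
Proof. apply: sigma_coord_measurable; exact: sigma_coord_off. Qed.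

(** Under [k] the spins off [V] are almost surely those of [w], so that they may
    be replaced by the latter. The new integrand is local, whatever [F] is. *)
Lemma avg_off (k : probability Omega R) V w (F : Omega -> R) :
  k (off_set V w) = 1%E -> bounded_measurable F ->
  \int[k]_s F s = \int[k]_s F (splice V s w).
Proof.
move=> k1 bF; apply: (avg_ae (measurable_off V w)) => //.
  exact/local_bm/local_splice.
move=> s sw; congr F; apply/funext => x; rewrite /splice.
by case: ifPn => // /sw.
Qed.

Variable g : kernel_family R L E.
Hypothesis gs : is_specification g.

(** A function measurable with respect to F_D, with [D] the complement of [Lam],
    ignores the spins in [Lam]. *)
Lemma spec_depends Lam A : measurable A ->
  depends_on (~` [set` Lam]) (fun w => g Lam w A).
Proof.
move=> mA w s ws.
have m1 : measurable [set g Lam w A] by exact: emeasurable_set1.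
have := sigma_coord_depends (spec_measurable gs (Lam := Lam) mA m1) ws => /= h.
by apply: esym; rewrite -h.
Qed.

Lemma kapp_depends Lam f : depends_on (~` [set` Lam]) (kapp g Lam f).
Proof.
by move=> w s ws; apply: avg_prob_eq => A mA; apply: spec_depends.
Qed.

Lemma spec_kernel_measurable Lam A : measurable A ->
  measurable_fun setT (fun w => g Lam w A).
Proof.
move=> mA _ Y mY; rewrite setTI.
apply: sigma_coord_measurable; exact: (spec_measurable gs (Lam := Lam) mA mY).
Qed.

Lemma bm_kernel (k : Omega -> probability Omega R) A : measurable A ->
  measurable_fun setT (fun w => k w A) ->
  bounded_measurable (fun w => fine (k w A)).
Proof.
move=> mA mk; split; first exact: measurableT_comp.
exists 1 => s; rewrite ger0_norm ?fine_ge0 //.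
by rewrite -lee_fin -prob_fin // probability_le1.
Qed.

Lemma bm_avg_kernel (k : Omega -> probability Omega R) f :
  (forall A, measurable A -> measurable_fun setT (fun w => k w A)) ->
  local_fun f -> bounded_measurable (fun w => \int[k w]_s f s).
Proof.
move=> mk [S df].
rewrite (_ : (fun w => _) = fun w => \sum_(p : pattern E S)
    f (extend p) * fine (k w (cyl S (extend p)))).
  apply: bm_sum => p; apply: bm_mul; first exact: bm_cst.
  apply: bm_kernel; first exact: measurable_cyl.
  by apply: mk; exact: measurable_cyl.
by apply/funext => w; apply: avg_depends1.
Qed.

Lemma bm_kapp Lam f : local_fun f -> bounded_measurable (kapp g Lam f).
Proof. by apply: bm_avg_kernel => A; apply: spec_kernel_measurable. Qed.

Lemma spec_off V w : g V w (off_set V w) = 1%E.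
Proof.
rewrite (spec_proper gs) ?indicE ?mem_set //; exact: sigma_coord_off.
Qed.

(** Properness: [v] is almost surely constant under [g Lam w]. *)
Lemma kapp_pull Lam v f w : depends_on (~` [set` Lam]) v ->
  bounded_measurable v -> bounded_measurable f ->
  kapp g Lam (fun s => v s * f s) w = v w * kapp g Lam f w.
Proof.
move=> dv bv bf; rewrite /kapp -avg_scale //.
apply: (avg_ae (measurable_off Lam w) (spec_off _ _)); first exact: bm_mul.
  by apply: bm_mul => //; exact: bm_cst.
by move=> s sw; congr (_ * _); apply: dv => x /negP /sw.
Qed.

Lemma avg_gibbs (k : Omega -> probability Omega R) mu f :
  (forall A, measurable A -> measurable_fun setT (fun w => k w A)) ->
  (forall A, measurable A -> (\int[mu]_w k w A = mu A)%E) ->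
  local_fun f -> \int[mu]_w (\int[k w]_s f s) = \int[mu]_s f s.
Proof.
move=> mk kE [S df]; rewrite [RHS](avg_depends1 _ df).
under eq_Rintegral => w _ do rewrite (avg_depends1 _ df).
rewrite avg_sum; last first.
  move=> p; apply: bm_mul; first exact: bm_cst.
  by apply: bm_kernel; [|apply: mk]; exact: measurable_cyl.
apply: eq_bigr => p _; have mC := measurable_cyl S (extend p : Omega).
rewrite avg_scale; last by apply: bm_kernel => //; exact: mk.
congr (_ * _); rewrite -kE //; congr fine; apply: eq_integral => w _.
by rewrite -prob_fin.
Qed.

Lemma kapp_consistent Lam V f w : (Lam `<=` V)%fset -> local_fun f ->
  kapp g V (kapp g Lam f) w = kapp g V f w.
Proof.
move=> LV lf; apply: avg_gibbs => // A mA; first exact: spec_kernel_measurable.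
exact: (spec_consistent gs LV w mA).
Qed.

End Specification.

(** * Monotone local functions *)

Section Order.
Context (R : realType) (L : countType) (disp : Order.disp_t)
  (E : finTBOrderType disp).
Notation Omega := (config L E).
Implicit Types (b : bool) (S T V Lam : {fset L}) (w s t th : Omega)
  (mu nu : probability Omega R) (f h v : Omega -> R).

(** The flag [b] exchanges the order and its opposite, and with them the two
    extreme boundary conditions, so that every statement about one of them is a
    statement about the other. *)
Definition config_ord b w s : Prop :=
  if b then config_le w s else config_le s w.

Definition extreme b : Omega := cst (if b then \top%O else \bot%O).

Definition monotone b f : Prop := forall w s, config_ord b w s -> f w <= f s.

Lemma config_ordN b w s : config_ord (~~ b) w s = config_ord b s w.
Proof. by case: b. Qed.

Lemma monotoneN b f : monotone b f -> monotone (~~ b) (fun w => - f w).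
Proof. by move=> mf w s; rewrite config_ordN lerN2; apply: mf. Qed.

Lemma splice_le_extreme b S w : config_ord b w (splice S w (extreme b)).
Proof.
by case: b => x; rewrite /splice; case: ifP => //= _; rewrite ?lex1 ?le0x.
Qed.

Lemma splice_anti b S T w : (S `<=` T)%fset ->
  config_ord b (splice T w (extreme b)) (splice S w (extreme b)).
Proof.
move=> /fsubsetP ST.
case: b => x; rewrite /splice; have [xS|xS] := boolP (x \in S);
  have [xT|xT] := boolP (x \in T); rewrite /extreme /= ?lex1 ?le0x //;
  by rewrite (ST _ xS) in xT.
Qed.

Lemma splice_mono b S w s th :
  config_ord b w s -> config_ord b (splice S w th) (splice S s th).
Proof. by case: b => ws x; rewrite /splice; case: ifP. Qed.

Lemma splice_extremes b S w :
  config_ord b (splice S w (extreme (~~ b))) (splice S w (extreme b)).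
Proof.
by case: b => x; rewrite /splice; case: ifP => //= _; rewrite ?lex1 ?le0x.
Qed.

Lemma kapp_monotone (g : kernel_family R L E) b Lam f :
  monotonicity_preserving g -> bounded_measurable f -> monotone b f ->
  monotone b (kapp g Lam f).
Proof.
move=> gm bf; have [mf _] := bf; case: b => mono w s ws.
  exact: (gm Lam f mf mono).
have : kapp g Lam (fun t => - f t) s <= kapp g Lam (fun t => - f t) w.
  apply: gm => //; first by have [] := bm_opp bf.
  by move=> t u tu; rewrite lerN2; apply: mono.
by rewrite /kapp !avg_opp // lerN2.
Qed.

(** Adding a large multiple of the strictly increasing function that sums the
    ranks of the spins in [S] makes any function of these spins increasing. *)
Lemma local_monotone_sub b f : local_fun f -> exists f1 f2,
  [/\ local_fun f1, local_fun f2, monotone b f1, monotone b f2 &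
      forall w, f w = f1 w - f2 w].
Proof.
move=> lf; have [S dS] := lf; have [mf [M fM]] := local_bm lf.
pose rank (e : E) : R := #|[pred e' : E | (e' < e)%O]|%:R.
have rank_le (e e' : E) : (e <= e')%O -> rank e <= rank e'.
  move=> ee; rewrite ler_nat; apply/subset_leq_card/fintype.subsetP => a.
  by rewrite !inE => /lt_le_trans; apply.
have rank_lt (e e' : E) : (e < e')%O -> rank e + 1 <= rank e'.
  move=> ee; rewrite /rank natr1 ler_nat; apply/proper_card/fintype.properP; split.
    by apply/fintype.subsetP => a; rewrite !inE => /lt_trans; apply.
  by exists e; rewrite inE ?ltxx.
have M0 : 0 <= M by rewrite (le_trans _ (fM (extreme b))).
pose m w : R := \sum_(x <- S) rank (w x).
have lm : local_fun m.
  by exists S => w s ws; apply: eq_big_seq => x xS; rewrite ws.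
have m_mono w s : config_le w s -> m w <= m s.
  by move=> ws; apply: ler_sum => x _; apply: rank_le.
have m_lt w s : config_le w s -> f w != f s -> m w + 1 <= m s.
  move=> ws; have [h|] := boolP [forall x : S, w (val x) == s (val x)].
    rewrite (dS w s) ?eqxx // => x xS.
    by have /eqP := forallP h (FSetSub xS).
  rewrite negb_forall => /existsP[[x xS] /= nx] _.
  rewrite /m (big_rem x) //= [leRHS](big_rem x) //= addrAC lerD //.
    by apply: rank_lt; rewrite lt_neqAle nx ws.
  by apply: ler_sum => y _; apply: rank_le.
pose m' w := if b then m w else - m w.
have lm' : local_fun m' by apply: (local_comp (fun x => if b then x else - x)).
have m'_mono w s : config_ord b w s -> m' w <= m' s.
  by rewrite /m' /config_ord; case: b {m' lm'} => ws; rewrite ?lerN2; apply: m_mono.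
have m'_lt w s : config_ord b w s -> f w != f s -> m' w + 1 <= m' s.
  rewrite /m' /config_ord; case: b {m' lm' m'_mono} => ws h; first exact: m_lt.
  by rewrite eq_sym in h; have := m_lt _ _ ws h; lra.
(* [f] drops by at most [2 * M], while [m'] grows by at least 1 whenever [f]
   changes. *)
exists (fun w => f w + (2 * M) * m' w), (fun w => (2 * M) * m' w); split.
- by apply: (local_comp2 (fun x y => x + 2 * M * y)).
- by apply: (local_comp (fun x => 2 * M * x)).
- move=> w s ws; have [->|fws] := eqVneq (f w) (f s).
    by rewrite lerD2l ler_wpM2l ?m'_mono // mulr_ge0.
  have h := m'_lt _ _ ws fws.
  have : 2 * M * (m' w + 1) <= 2 * M * m' s by rewrite ler_wpM2l // mulr_ge0.
  have := fM w; have := fM s; rewrite !ler_norml => /andP[? ?] /andP[? ?].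
  by lra.
- by move=> w s ws; rewrite ler_wpM2l ?m'_mono // mulr_ge0.
- by move=> w; rewrite addrK.
Qed.

(** Local limits and identities that are stable under subtraction only have to be
    established for monotone functions, for which inequalities are available. *)
Lemma local_monotone_ind b (P : (Omega -> R) -> Prop) :
  (forall f, local_fun f -> monotone b f -> P f) ->
  (forall f h, local_fun f -> local_fun h -> P f -> P h ->
     P (fun w => f w - h w)) ->
  forall f, local_fun f -> P f.
Proof.
move=> Pm Psub f /(local_monotone_sub b) [f1 [f2 [l1 l2 m1 m2 fE]]].
rewrite (_ : f = fun w => f1 w - f2 w); last exact/funext.
by apply: Psub => //; apply: Pm.
Qed.

(** Dominated convergence needs sequences; this one is cofinal among the finite
    volumes because [L] is countable. *)
Definition exhaustion n : {fset L} := [fset x in pmap choice.unpickle (iota 0 n)]%fset.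

Lemma exhaustion_totally : exhaustion n @[n --> \oo] --> summability.totally.
Proof.
move=> A [T _ TA]; exists (\max_(x <- T) (choice.pickle x).+1)%N => // n /= hn.
apply: TA => /=; apply/fsubsetP => x xT.
rewrite !inE mem_pmap -[Some x](choice.pickleK x); apply: map_f.
rewrite mem_iota add0n /=; apply: leq_trans hn.
exact: (@leq_bigmax_seq _ _ xpredT (fun x => (choice.pickle x).+1)).
Qed.

End Order.

Arguments extreme {L disp E} b.

(** * Freezing the spins off a finite volume *)

Section Dominated.
Context (R : realType) (d : measure_display) (T : measurableType d).

Lemma avg_cvg (mu : probability T R) (F : nat -> T -> R) (f : T -> R) (M : R) :
  (forall n, measurable_fun setT (F n)) -> (forall n x, `|F n x| <= M) ->
  (forall x, F n x @[n --> \oo] --> f x) ->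
  bounded_measurable f /\ \int[mu]_x F n x @[n --> \oo] --> \int[mu]_x f x.
Proof.
move=> mF FM Ff; have mf : measurable_fun setT f.
  by apply: (measurable_fun_cvg mF) => x _; apply: Ff.
have fM x : `|f x| <= M.
  have Ffx : `|F n x| @[n --> \oo] --> `|f x| by apply: cvg_norm; apply: Ff.
  by apply: (cvgr_to_le Ffx); apply: nearW => n.
have bf : bounded_measurable f by split => //; exists M.
split=> //; have bF n : bounded_measurable (F n) by split => //; exists M.
have mF' n : measurable_fun setT (EFin \o F n) by exact/measurable_EFinP.
have mf' : measurable_fun setT (EFin \o f) by exact/measurable_EFinP.
have [|||_ _] := @dominated_convergence _ _ _ mu setT measurableT
  (fun n => EFin \o F n) (EFin \o f) (cst M%:E) mF' mf'.
- apply: aeW => x _; apply: cvg_EFin; last exact: Ff.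
  exact: nearW.
- exact: (bm_integrable mu (bm_cst T M)).
- by apply: aeW => x n _; rewrite lee_fin.
by rewrite [X in _ --> X](avg_EFin mu bf) => /fine_cvg.
Qed.

End Dominated.

Section TotallyLimits.
Context (R : realType) (L : choiceType).
Implicit Types (F G H : {fset L} -> R) (T : {fset L}).
Notation totally := (@summability.totally L).


Lemma totally_le F G (l m : R) T : F S @[S --> totally] --> l ->
  G S @[S --> totally] --> m ->
  (forall S, (T `<=` S)%fset -> F S <= G S) -> l <= m.
Proof.
move=> Fl Gm h; rewrite -subr_ge0.
apply: (cvgr_to_ge (F := totally) (cvgB Gm Fl)).
by exists T => // S TS; rewrite subr_ge0 h.
Qed.

Lemma totally_le_cst F (l m : R) T : F S @[S --> totally] --> l ->
  (forall S, (T `<=` S)%fset -> F S <= m) -> l <= m.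
Proof. by move=> Fl; apply: totally_le Fl _; apply: cvg_cst. Qed.

Lemma totally_ge_cst F (l m : R) T : F S @[S --> totally] --> l ->
  (forall S, (T `<=` S)%fset -> m <= F S) -> m <= l.
Proof. by move=> Fl; apply: totally_le _ Fl; apply: cvg_cst. Qed.

Lemma totally_squeeze F G (l : R) T : G S @[S --> totally] --> l ->
  (forall S, (T `<=` S)%fset -> l <= F S <= G S) -> F S @[S --> totally] --> l.
Proof.
move=> /cvgrPdist_lt Gl h; apply/cvgrPdist_lt => e /Gl [T' _ hT'].
exists (T `|` T')%fset => // S /=; rewrite fsubUset => /andP[/h/andP[h1 h2]].
move=> /hT' /=; rewrite !ler0_norm ?subr_le0 // ?(le_trans h1 h2) //.
by lra.
Qed.

Lemma totally_eq F G (l : R) T : G S @[S --> totally] --> l ->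
  (forall S, (T `<=` S)%fset -> F S = G S) -> F S @[S --> totally] --> l.
Proof.
move=> Gl h; apply: cvg_trans Gl; apply: near_eq_cvg.
by exists T => // S /h ->.
Qed.

End TotallyLimits.

Section Limit.
Context (R : realType) (L : countType) (disp : Order.disp_t)
  (E : finTBOrderType disp).
Notation Omega := (config L E).
Notation totally := summability.totally.
Implicit Types (b : bool) (S T V Lam : {fset L}) (w s t th : Omega)
  (mu nu : probability Omega R) (f h v : Omega -> R).


Variable g : kernel_family R L E.
Hypothesis gs : is_specification g.
Hypothesis gm : monotonicity_preserving g.

(** The local approximations of the limit kernels: they decrease, as [S] grows,
    to the limit kernel applied to [f] when [f] is monotone for [b]. *)
Definition frozen b Lam f S : Omega -> R :=
  fun w => kapp g Lam f (splice S w (extreme b)).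

Lemma local_frozen b Lam f S : local_fun (frozen b Lam f S).
Proof. exact: local_splice. Qed.

Lemma bm_frozen b Lam f S : bounded_measurable (frozen b Lam f S).
Proof. exact/local_bm/local_frozen. Qed.

Lemma frozen_norm b Lam f S w (M : R) : bounded_measurable f ->
  (forall s, `|f s| <= M) -> `|frozen b Lam f S w| <= M.
Proof. exact: avg_norm. Qed.

Lemma frozen_monotone b c Lam f S : bounded_measurable f -> monotone b f ->
  monotone b (frozen c Lam f S).
Proof.
move=> bf mf w s ws; apply: (kapp_monotone (b := b)) => //.
exact: splice_mono.
Qed.

Lemma frozen_anti b Lam f S T w : bounded_measurable f -> monotone b f ->
  (S `<=` T)%fset -> frozen b Lam f T w <= frozen b Lam f S w.
Proof.
by move=> bf mf ST; apply: (kapp_monotone (b := b)) => //; apply: splice_anti.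
Qed.

Lemma kapp_le_frozen b Lam f S w : bounded_measurable f -> monotone b f ->
  kapp g Lam f w <= frozen b Lam f S w.
Proof.
by move=> bf mf; apply: (kapp_monotone (b := b)) => //; apply: splice_le_extreme.
Qed.

Section Squeeze.
Variables (b : bool) (k : {fset L} -> probability Omega R)
  (nu : probability Omega R) (S0 : {fset L}) (Lam : {fset L}).
Hypothesis k_cvg : forall f, local_fun f ->
  \int[k S]_s f s @[S --> totally] --> (\int[nu]_s f s : R).
Hypothesis k_anti : forall S T f, (S0 `<=` S)%fset -> (S `<=` T)%fset ->
  local_fun f -> monotone b f -> \int[k T]_s f s <= \int[k S]_s f s.
Hypothesis k_consistent : forall S f, (S0 `<=` S)%fset -> local_fun f ->
  \int[k S]_s kapp g Lam f s = \int[k S]_s f s.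
Hypothesis k_off : forall S, (S0 `<=` S)%fset -> k S (off_set S (extreme b)) = 1%E.

(** For monotone [f] the average of [frozen b Lam f S] under [nu] lies between
    those of [f] under [nu] and under [k S]. It is at least the former because
    freezing spins at the extreme value raises [kapp g Lam f]. It is at most the
    latter because under [k S] these spins are frozen already, so that [k S]
    gives [frozen b Lam f S] the same average as [f], and because the averages of
    monotone functions under [k S] decrease to those under [nu]. *)
Lemma frozen_cvg f : local_fun f ->
  \int[nu]_s frozen b Lam f S s @[S --> totally] --> (\int[nu]_s f s : R).
Proof.
move: f; apply: (local_monotone_ind (b := b)) => [f lf mf|f h lf lh IHf IHh]; last first.
  rewrite avg_sub //; try exact: local_bm.
  rewrite (_ : (fun S => _) = fun S =>
    \int[nu]_s frozen b Lam f S s - \int[nu]_s frozen b Lam h S s).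
    exact: cvgB.
  apply/funext => S; rewrite -avg_sub; try exact: bm_frozen.
  by apply: eq_Rintegral => s _; rewrite /frozen /kapp avg_sub //; exact: local_bm.
have bf := local_bm lf.
apply: (totally_squeeze (T := S0) (k_cvg lf)) => S S0S; apply/andP; split.
  apply: (totally_le (T := S0) (k_cvg lf) (k_cvg (local_frozen b Lam f S))).
  move=> T S0T; rewrite -(k_consistent S0T lf).
  apply: avg_le; first exact: (bm_kapp gs).
    exact: bm_frozen.
  by move=> s; apply: kapp_le_frozen.
rewrite -(k_consistent S0S lf).
rewrite (avg_off (k_off S0S)); last exact: (bm_kapp gs).
apply: (totally_le_cst (T := S) (k_cvg (local_frozen b Lam f S))) => T ST.
apply: k_anti => //; first exact: local_frozen.
exact: frozen_monotone.
Qed.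

End Squeeze.

Section Boundary.
Variables (b : bool) (gth : kernel_family R L E).
Hypothesis gthE : boundary_limit g (extreme b) gth.

Lemma frozen_exhaustion Lam f w : local_fun f ->
  frozen b Lam f (exhaustion L n) w @[n --> \oo] --> kapp gth Lam f w.
Proof.
move=> lf; exact: (@cvg_comp _ _ _ (exhaustion L)
  (fun S => kapp g Lam f (splice S w (extreme b)))
  _ _ _ (@exhaustion_totally L) (@gthE Lam w _ lf)).
Qed.

Lemma avg_frozen_exhaustion mu Lam f : local_fun f ->
  bounded_measurable (kapp gth Lam f) /\
  \int[mu]_w frozen b Lam f (exhaustion L n) w @[n --> \oo] -->
    \int[mu]_w kapp gth Lam f w.
Proof.
move=> lf; have [mf [M fM]] := local_bm lf.
apply: (@avg_cvg _ _ _ _ _ _ M) => [n|n w|w].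
- by have [] := bm_frozen b Lam f (exhaustion L n).
- by apply: frozen_norm => //; exact: local_bm.
- exact: frozen_exhaustion.
Qed.

Lemma bm_kapp_limit Lam f : local_fun f -> bounded_measurable (kapp gth Lam f).
Proof. by move=> lf; have [] := avg_frozen_exhaustion (g Lam (extreme b)) Lam lf. Qed.

(** The frozen functions converge boundedly to the limit kernel, along any
    cofinal sequence of volumes. *)
Lemma frozen_cvg_gibbs mu Lam f : local_fun f ->
  \int[mu]_w frozen b Lam f S w @[S --> totally] --> (\int[mu]_w f w : R) ->
  \int[mu]_w kapp gth Lam f w = \int[mu]_w f w.
Proof.
move=> lf h; have [_ c1] := avg_frozen_exhaustion mu Lam lf.
have c2 := @cvg_comp _ _ _ (exhaustion L) (fun S => \int[mu]_w frozen b Lam f S w)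
  _ _ _ (@exhaustion_totally L) h.
exact: (cvg_unique _ c1 c2).
Qed.

Lemma limit_le_frozen Lam f S w : local_fun f -> monotone b f ->
  kapp gth Lam f w <= frozen b Lam f S w.
Proof.
move=> lf mf; apply: (totally_le_cst (T := S) (@gthE Lam w _ lf)) => T ST.
by apply: frozen_anti => //; exact: local_bm.
Qed.

Lemma frozenN_le_limit Lam f S w : local_fun f -> monotone b f ->
  frozen (~~ b) Lam f S w <= kapp gth Lam f w.
Proof.
move=> lf mf; have bf := local_bm lf.
apply: (totally_ge_cst (T := S) (@gthE Lam w _ lf)) => T ST.
apply: (le_trans (y := frozen (~~ b) Lam f T w)); last first.
  by apply: (kapp_monotone (b := b)) => //; apply: splice_extremes.
have := @frozen_anti (~~ b) Lam _ S T w (bm_opp bf) (monotoneN mf) ST.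
by rewrite /frozen /kapp !avg_opp // lerN2.
Qed.

End Boundary.

End Limit.

(** * The limit specifications and their Gibbs measures *)

Lemma prob1_subset (R : realType) (d : measure_display) (T : measurableType d)
    (mu : probability T R) (A B : set T) :
  measurable A -> measurable B -> A `<=` B -> mu A = 1%E -> mu B = 1%E.
Proof.
move=> mA mB AB A1; apply/eqP; rewrite eq_le probability_le1 //= -A1.
by apply: le_measure => //; rewrite inE.
Qed.

Section LimitSpecification.
Context (R : realType) (L : countType) (disp : Order.disp_t)
  (E : finTBOrderType disp).
Notation Omega := (config L E).
Notation totally := summability.totally.
Implicit Types (S T V Lam : {fset L}) (w s t th : Omega)
  (mu nu : probability Omega R) (f h v : Omega -> R).

Variables (g gth : kernel_family R L E) (b : bool).
Hypothesis gs : is_specification g.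
Hypothesis gm : monotonicity_preserving g.
Hypothesis gthE : boundary_limit g (extreme b) gth.

Lemma frozen_depends c Lam f S :
  depends_on [set` (S `\` Lam)%fset] (frozen g c Lam f S).
Proof.
move=> w s ws; apply: (kapp_depends gs) => x /= xL; rewrite /splice.
case: ifPn => // xS; apply: ws => /=.
by rewrite inE xS andbT; apply/negP.
Qed.

Lemma limit_measurable Lam A : measurable A ->
  measurable_fun (setT : set (g_sigma_algebraType (@cylinders L disp E (~` [set` Lam]))))
    (fun w => gth Lam w A).
Proof.
move: A; apply: sigma_coord_ind => [|S w _|A mA IH|F mF tF IH].
- rewrite (_ : (fun w => _) = cst 0%E); last by apply/funext => w; exact: measure0.
  exact: measurable_cst.
- have lc := @local_cyl L disp E R S w.
  rewrite (_ : (fun s => _) = EFin \o kapp gth Lam (\1_(cyl S w))); last first.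
    apply/funext => s /=; rewrite /kapp avg_cyl.
    by apply: prob_fin; exact: measurable_cyl.
  apply/measurable_EFinP.
  apply: (@measurable_fun_cvg _
    (g_sigma_algebraType (@cylinders L disp E (~` [set` Lam]))) R setT
    (fun n => frozen g b Lam (\1_(cyl S w)) (exhaustion L n))) => [n|s _].
    apply: depends_measurable; last exact: frozen_depends.
    by move=> x /=; rewrite inE => /andP[/negP].
  exact: frozen_exhaustion.
- rewrite (_ : (fun w => _) = fun w => (1 - gth Lam w A)%E); last first.
    by apply/funext => w; apply: probability_setC; exact: sigma_coord_measurable mA.
  by apply: emeasurable_funB => //; exact: measurable_cst.
- have mF' n : measurable (F n) by exact: mF.
  rewrite (_ : (fun w => _) = fun w => (\sum_(n <oo) gth Lam w (F n))%E); last first.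
    apply/funext => w; apply: measure_semi_bigcup => //; exact: bigcupT_measurable.
  by apply: ge0_emeasurable_sum.
Qed.

Lemma limit_proper Lam B w : sigma_coord (~` [set` Lam]) B ->
  gth Lam w B = (\1_B w)%:E.
Proof.
move: B; apply: sigma_coord_ind => [|S s SL|A mA IH|F mF tF IH].
- by rewrite measure0 indicE in_set0.
- rewrite [LHS]prob_fin; last exact: measurable_cyl.
  congr EFin; rewrite -avg_cyl.
  have lc := @local_cyl L disp E R S s.
  have h : frozen g b Lam (\1_(cyl S s)) T w @[T --> totally] --> (\1_(cyl S s) w : R).
    apply: (@totally_eq _ _ _ (fun=> \1_(cyl S s) w) _ S).
      exact: cvg_cst.
    move=> T ST; rewrite /frozen.
    transitivity (kapp g Lam (fun t => \1_(cyl S s) t * 1) (splice T w (extreme b))).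
      by apply: eq_Rintegral => t _; rewrite mulr1.
    rewrite (kapp_pull gs); last 3 first.
    + exact: dependsS SL (@depends_cyl _ _ _ _ _ _).
    + exact: bm_cyl.
    + exact: bm_cst.
    rewrite /kapp avg_cst mulr1; apply: (@depends_cyl _ _ _ _ S s) => x xS.
    by rewrite splice_in // (fsubsetP ST).
  have c1 := @cvg_comp _ _ _ (exhaustion L) (fun T => frozen g b Lam (\1_(cyl S s)) T w)
    _ _ _ (@exhaustion_totally L) h.
  have c2 := @frozen_exhaustion R L disp E g b gth gthE Lam _ w lc.
  exact: (cvg_unique _ c2 c1).
- have mA' := sigma_coord_measurable mA.
  rewrite probability_setC // IH !indicE in_setC.
  by case: (w \in A) => /=; rewrite ?sube0 ?subee.
- have mF' n : measurable (F n) := sigma_coord_measurable (mF n).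
  have mU : measurable (\bigcup_n F n) by exact: bigcupT_measurable.
  have [[n _ Fnw]|nFw] := pselect ((\bigcup_n F n) w).
    rewrite indicE mem_set; last by exists n.
    apply: (prob1_subset (mF' n)) => //; first exact: bigcup_sup.
    by rewrite IH indicE mem_set.
  rewrite indicE memNset // measure_semi_bigcup // eseries0 // => n _ _.
  transitivity ((\1_(F n) w)%:E : \bar R); first exact: IH.
  by rewrite indicE memNset // => Fnw; apply: nFw; exists n.
Qed.

Lemma limit_kernel_measurable Lam A : measurable A ->
  measurable_fun setT (fun w => gth Lam w A).
Proof.
move=> mA _ Y mY; rewrite setTI.
have := @limit_measurable Lam A mA (@measurableT _ _) Y mY.
by rewrite setTI; apply: sigma_coord_measurable.
Qed.

(** The kernel of [V] of the limit specification at [w] is itself a limit along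
    [S] of measures carried by configurations that are extreme off [S], namely
    the kernels of [V] at [splice S w (extreme b)]: consistency is thus the same
    statement as the Gibbs property of the limit measures. *)
Lemma limit_specification : is_specification gth.
Proof.
split=> [Lam A mA Y mY|Lam B w|Lam V LV w].
- have := @limit_measurable Lam A mA (@measurableT _ _) Y mY.
  by rewrite setTI.
- exact: limit_proper.
apply: mixture_eq => [A mA|f lf]; first exact: limit_kernel_measurable.
apply: (frozen_cvg_gibbs gthE) => //.
apply: (@frozen_cvg _ _ _ _ g gs gm b (fun S => g V (splice S w (extreme b)))
  (gth V w) V Lam) => //.
- by move=> h lh; exact: gthE.
- move=> S T h VS ST lh mh; apply: (frozen_anti gm) => //; exact: local_bm.
- by move=> S h VS lh; apply: (kapp_consistent gs).
- move=> S VS; apply: prob1_subset (spec_off gs V _); try exact: measurable_off.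
  move=> s h x xS; rewrite h ?splice_out //.
  by apply: contra xS; apply: (fsubsetP VS).
Qed.

(** Larger volumes have less extreme spins around a given region, so that the
    averages of monotone functions decrease with the volume. *)
Lemma volume_limit_frozen_cvg mu Lam f : volume_limit g (extreme b) mu ->
  local_fun f ->
  \int[mu]_s frozen g b Lam f S s @[S --> totally] --> (\int[mu]_s f s : R).
Proof.
move=> muE; apply: (@frozen_cvg _ _ _ _ g gs gm b (fun S => g S (extreme b)) mu Lam Lam).
- by move=> h lh; apply: muE.
- move=> S T h LS ST lh mh.
  have bh := local_bm lh.
  have -> : \int[g T (extreme b)]_s h s = kapp g T (kapp g S h) (extreme b).
    by rewrite (kapp_consistent gs).
  rewrite -[leRHS](avg_cst (g T (extreme b))); apply: avg_le.
  + exact: (bm_kapp gs).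
  + exact: bm_cst.
  + move=> s; apply: (@kapp_monotone R L disp E g b S h gm bh mh).
    by have := splice_le_extreme b fset0 s; rewrite (_ : splice fset0 s _ = extreme b) //.
- by move=> S h LS lh; apply: (kapp_consistent gs).
- by move=> S LS; apply: spec_off.
Qed.

Lemma volume_limit_gibbs mu : volume_limit g (extreme b) mu -> gibbs gth mu.
Proof.
move=> muE Lam; apply: mixture_eq => [A mA|f lf].
  exact: limit_kernel_measurable.
apply: (frozen_cvg_gibbs gthE) => //; exact: volume_limit_frozen_cvg.
Qed.

End LimitSpecification.

(** * Continuity sets *)

Lemma dist_half (R : realFieldType) (x y z e : R) :
  `|x - y| < e / 2 -> `|x - z| < e / 2 -> `|y - z| <= e.
Proof.
rewrite !ltr_norml => /andP[? ?] /andP[? ?].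
by rewrite ler_norml; apply/andP; split; lra.
Qed.

Lemma prob1_bigcapT (R : realType) (d : measure_display) (T : measurableType d)
    (mu : probability T R) (U : countType) (F : U -> set T) :
  (forall i, measurable (F i)) -> (forall i, mu (F i) = 1%E) ->
  mu (\bigcap_i F i) = 1%E.
Proof.
move=> mF F1; have mI := countable_bigcapT_measurable mF.
pose G n := if choice.unpickle n is Some i then ~` F i else set0.
have mG n : measurable (G n).
  by rewrite /G; case: choice.unpickle => // i; exact: measurableC.
have G0 n : mu.-negligible (G n).
  apply/negligibleP => //; rewrite /G; case: choice.unpickle => [i|].
    have h : mu (~` F i) = 0%E by rewrite probability_setC // F1 subee.
    exact: h.
  exact: measure0.
have GE : ~` (\bigcap_i F i) = \bigcup_n G n.
  rewrite setC_bigcap; apply/seteqP; split=> x [i _ h].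
    by exists (choice.pickle i) => //; rewrite /G choice.pickleK.
  by move: h; rewrite /G; case: choice.unpickle => // j Fj; exists j.
have : mu (~` (\bigcap_i F i)) = 0%E.
  have /negligibleP := negligible_bigcup G0; rewrite -GE; apply.
  exact: measurableC.
by rewrite probability_setC // => /eqP; rewrite sube_eq // add0e => /eqP ->.
Qed.

Section ContinuousAt.
Context (R : realType) (T : topologicalType).
Implicit Types (F G : T -> R) (w : T).

Lemma continuous_at_sub F G w : {for w, continuous F} -> {for w, continuous G} ->
  {for w, continuous (fun s => F s - G s)}.
Proof. by move=> cF cG; apply: cvgB. Qed.

Lemma continuous_at_sum (I : Type) (r : seq I) (c : I -> R) (F : I -> T -> R) w :
  (forall i, {for w, continuous (F i)}) ->
  {for w, continuous (fun s => \sum_(i <- r) c i * F i s)}.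
Proof.
move=> cF; elim: r => [|i r IH].
  rewrite (_ : (fun=> _) = fun=> 0); last by apply/funext => s; rewrite big_nil.
  exact: cvg_cst.
rewrite (_ : (fun s => _) = fun s => c i * F i s + \sum_(j <- r) c j * F j s).
  by apply: cvgD => //; apply: cvgM; [exact: cvg_cst|exact: cF].
by apply/funext => s; rewrite big_cons.
Qed.

End ContinuousAt.

Section Continuity.
Context (R : realType) (L : countType) (disp : Order.disp_t)
  (E : finTBOrderType disp).
Notation Omega := (config L E).
Notation totally := summability.totally.
Implicit Types (S T V Lam : {fset L}) (w s t th : Omega)
  (mu nu : probability Omega R) (f h v : Omega -> R).

Lemma nbhs_cylS S w (A : set Omega) : cyl S w `<=` A -> nbhs w A.
Proof.
move=> SA; exact: (@filterS Omega (nbhs w) (nbhs_filter w) _ _ SA (nbhs_cyl S w)).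
Qed.

Lemma continuous_at_cyl (F : Omega -> R) w :
  (forall e, 0 < e -> exists S, forall s, cyl S w s -> `|F w - F s| < e) ->
  {for w, continuous F}.
Proof.
move=> h; have FF : Filter (nbhs w) by exact: nbhs_filter.
have FFF : Filter (F @ w) by exact: fmap_filter.
apply: (proj2 (@cvgrPdist_lt R R Omega (nbhs w) FF F (F w))) => e /h [S hS].
exact: nbhs_cylS hS.
Qed.

Lemma depends_measurable_set S (A : set Omega) :
  depends_on [set` S] A -> measurable A.
Proof.
move=> dA.
have -> : A = \bigcup_(p : pattern E S)
    (if `[< A (extend p) >] then cyl S (extend p) else set0).
  apply/seteqP; split=> [w Aw|w [p _]].
    exists (observe S w) => //; rewrite asboolT; first exact/cyl_extend.
    by rewrite (dA _ w) // => x xS; rewrite extend_observe.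
  case: asboolP => // Ap wp; by rewrite (dA _ (extend p)).
apply: countable_bigcupT_measurable => [|p]; first exact: countableP.
by case: ifP => // _; exact: measurable_cyl.
Qed.

(** A G_delta set: the points that have, for every [n], a cylinder on which the
    oscillation is at most [1 / n.+1]. Membership for a given [n] and a given
    cylinder base is decided by finitely many spins. *)
Lemma measurable_continuity_points (F : Omega -> R) :
  measurable [set w | {for w, continuous F}].
Proof.
pose osc n S := [set w | forall s t, cyl S w s -> cyl S w t ->
  `|F s - F t| <= n.+1%:R^-1].
have -> : [set w | {for w, continuous F}] = \bigcap_n \bigcup_S osc n S.
  apply/seteqP; split=> w.
    move=> /= /cvgrPdist_lt cF n _.
    have n0 : 0 < (n.+1%:R^-1 / 2 : R) by rewrite divr_gt0.
    have [S hS] := cyl_nbhs (cF _ n0); exists S => // s t ws wt.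
    exact: dist_half (hS _ ws) (hS _ wt).
  move=> h; apply: continuous_at_cyl => e e0.
  have [n ne] : exists n, n.+1%:R^-1 < e.
    have [n _ hn] := near_infty_natSinv_lt (PosNum e0).
    by exists n; apply: (hn n) => /=.
  have [S _ hS] := h n I; exists S => s ws.
  by apply: le_lt_trans ne; apply: hS.
apply: bigcapT_measurable => n; apply: countable_bigcupT_measurable => // S.
apply: (@depends_measurable_set S) => w s ws; apply/propext.
rewrite /osc /=; have -> // : cyl S w = cyl S s.
by apply: esym; apply: eq_cyl => x xS; rewrite ws.
Qed.

Lemma kapp_depends_sum (g : kernel_family R L E) Lam S f w :
  depends_on [set` S] f ->
  kapp g Lam f w = \sum_(p : pattern E S)
    f (extend p) * kapp g Lam (\1_(cyl S (extend p))) w.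
Proof.
move=> df; rewrite /kapp (avg_depends1 _ df).
by apply: eq_bigr => p _; rewrite avg_cyl.
Qed.

(** Local functions are finite combinations of cylinder indicators, of which
    there are only countably many. *)
Lemma measurable_continuity_set (g : kernel_family R L E) :
  measurable (continuity_set g).
Proof.
have -> : continuity_set g = \bigcap_(Lam : {fset L}) \bigcap_(S : {fset L})
    \bigcap_(p : pattern E S)
      [set w | {for w, continuous (kapp g Lam (\1_(cyl S (extend p))))}].
  apply/seteqP; split=> [w cw Lam _ S _ p _|w cw Lam f [S df]].
    by apply: cw; exact: local_cyl.
  rewrite (_ : kapp g Lam f = fun w => \sum_(p : pattern E S)
    f (extend p) * kapp g Lam (\1_(cyl S (extend p))) w); last first.
    by apply/funext => s; apply: kapp_depends_sum.
  apply: continuous_at_sum => p; exact: cw.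
apply: countable_bigcapT_measurable => Lam.
apply: countable_bigcapT_measurable => S.
apply: countable_bigcapT_measurable => p.
exact: measurable_continuity_points.
Qed.

Lemma Omega_pmE (gp gm : kernel_family R L E) :
  Omega_pm gp gm = \bigcap_(Lam : {fset L}) \bigcap_(S : {fset L})
    \bigcap_(p : pattern E S) [set w | kapp gp Lam (\1_(cyl S (extend p))) w -
        kapp gm Lam (\1_(cyl S (extend p))) w = 0].
Proof.
apply/seteqP; split=> [w cw Lam _ S _ p _|w cw Lam f [S df]] /=.
  by apply/eqP; rewrite subr_eq0; apply/eqP/cw; exact: local_cyl.
rewrite !(kapp_depends_sum _ _ _ df); apply: eq_bigr => p _; congr (_ * _).
by apply/eqP; rewrite -subr_eq0; apply/eqP/(cw Lam I S I p I).
Qed.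

Section OmegaPm.
Variables gp gm : kernel_family R L E.
Hypothesis bp : forall Lam f, local_fun f -> bounded_measurable (kapp gp Lam f).
Hypothesis bm : forall Lam f, local_fun f -> bounded_measurable (kapp gm Lam f).

Lemma measurable_kapp_eq Lam f : local_fun f ->
  measurable [set w | kapp gp Lam f w - kapp gm Lam f w = 0].
Proof.
move=> lf; have [mF _] := bm_sub (bp Lam lf) (bm Lam lf).
by rewrite -[X in measurable X]setTI; exact: (mF measurableT [set 0]).
Qed.

Lemma measurable_Omega_pm : measurable (Omega_pm gp gm).
Proof.
rewrite Omega_pmE; do 3 apply: countable_bigcapT_measurable => ?.
by apply: measurable_kapp_eq; exact: local_cyl.
Qed.

Lemma Omega_pm_full mu :
  (forall Lam f, local_fun f ->
     mu [set w | kapp gp Lam f w - kapp gm Lam f w = 0] = 1%E) ->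
  mu (Omega_pm gp gm) = 1%E.
Proof.
move=> h; rewrite Omega_pmE.
have m1 Lam S p :=
  measurable_kapp_eq Lam (@local_cyl L disp E R S (@extend L disp E S p)).
apply: prob1_bigcapT => [Lam|Lam].
  by do 2 apply: countable_bigcapT_measurable => ?; exact: m1.
apply: prob1_bigcapT => [S|S].
  by apply: countable_bigcapT_measurable => p; exact: m1.
apply: prob1_bigcapT => [p|p]; first exact: m1.
by apply: h; exact: local_cyl.
Qed.

End OmegaPm.

End Continuity.

Section Between.
Context (R : realType) (L : countType) (disp : Order.disp_t)
  (E : finTBOrderType disp).
Notation Omega := (config L E).
Notation totally := summability.totally.
Implicit Types (S T V Lam : {fset L}) (w s t th : Omega)
  (mu nu : probability Omega R) (f h v : Omega -> R).

Variable g : kernel_family R L E.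
Hypothesis gs : is_specification g.
Hypothesis gm : monotonicity_preserving g.
Variable gl : bool -> kernel_family R L E.
Hypothesis glE : forall b, boundary_limit g (extreme b) (gl b).

(** The two bounds for the kernel [gl b] hold because the frozen functions for
    [b] decrease to it. For [gl (~~ b)] they are those for [- f], which is
    monotone for the opposite order. *)
Lemma limit_between b c Lam f S w : local_fun f -> monotone b f ->
  frozen g (~~ b) Lam f S w <= kapp (gl c) Lam f w <= frozen g b Lam f S w.
Proof.
move=> lf mf; have [cb|] := eqVneq c b.
  subst c; apply/andP; split; first exact: (frozenN_le_limit gm (@glE b)).
  exact: (limit_le_frozen gm (@glE b)).
move=> cb; have {cb}-> : c = ~~ b by case: b c cb {mf} => -[].
have lf' : local_fun (fun w => - f w) by apply: local_comp.
have mf' := monotoneN mf; have bf := local_bm lf.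
have := frozenN_le_limit gm (@glE (~~ b)) Lam S w lf' mf'.
have := limit_le_frozen gm (@glE (~~ b)) Lam S w lf' mf'.
by rewrite /frozen /kapp !avg_opp // !lerN2 negbK => -> ->.
Qed.

Lemma limit_ordered b c Lam f w : local_fun f -> monotone b f ->
  kapp (gl c) Lam f w <= kapp (gl b) Lam f w.
Proof.
move=> lf mf; apply: (totally_ge_cst (T := fset0) (@glE b Lam w _ lf)) => S _.
by have /andP[] := limit_between c Lam S w lf mf.
Qed.

Lemma limit_orderedN b c Lam f w : local_fun f -> monotone b f ->
  kapp (gl (~~ b)) Lam f w <= kapp (gl c) Lam f w.
Proof.
move=> lf mf; apply: (totally_le_cst (T := fset0) (@glE (~~ b) Lam w _ lf)) => S _.
by have /andP[] := limit_between c Lam S w lf mf.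
Qed.

(** Both limit kernels lie between two families of local functions. Where the
    kernels agree, the two families have a common limit and pin the kernels down
    on a whole cylinder up to any given error. *)
Lemma Omega_pm_continuity b c :
  Omega_pm (gl b) (gl (~~ b)) `<=` continuity_set (gl c).
Proof.
move=> w wpm Lam; apply: (local_monotone_ind (b := b)) => [f lf mf|f h lf lh IHf IHh].
  apply: continuous_at_cyl => e e0.
  have cE : kapp (gl c) Lam f w = kapp (gl b) Lam f w.
    apply/eqP; rewrite eq_le limit_ordered //= wpm //.
    exact: limit_orderedN.
  have [T1 _ h1] := (cvgrPdist_lt _ _).1 (@glE b Lam w _ lf) e e0.
  have [T2 _ h2] := (cvgrPdist_lt _ _).1 (@glE (~~ b) Lam w _ lf) e e0.
  pose S := (T1 `|` T2)%fset.
  have {}h1 := h1 S (fsubsetUl _ _); have {}h2 := h2 S (fsubsetUr _ _).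
  exists S => s ws.
  have [/andP[l u]] := limit_between c Lam S s lf mf.
  move: l u h1 h2 => /=; rewrite -(wpm Lam f lf) cE /frozen.
  have sE d : kapp g Lam f (splice S s (extreme d)) =
              kapp g Lam f (splice S w (extreme d)).
    exact: (@depends_splice L disp E R S (extreme d) (kapp g Lam f)).
  rewrite !sE !ltr_norml => ? ? /andP[? ?] /andP[? ?].
  by apply/andP; split; lra.
rewrite (_ : kapp (gl c) Lam _ = fun s => kapp (gl c) Lam f s - kapp (gl c) Lam h s).
  exact: continuous_at_sub.
by apply/funext => s; rewrite /kapp avg_sub //; exact: local_bm.
Qed.

End Between.

(** * Densities on cylinders and stochastic domination *)

Section Densities.
Context (R : realType) (L : countType) (disp : Order.disp_t)
  (E : finTBOrderType disp).
Notation Omega := (config L E).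
Notation totally := summability.totally.
Implicit Types (b c : bool) (S T V Lam D : {fset L}) (w s t th : Omega)
  (mu nu : probability Omega R) (f h v : Omega -> R).

(** The Radon-Nikodym derivative on F_S. On a null cylinder of [nu] the quotient
    is 0, which is harmless under domination. *)
Definition density mu nu S : Omega -> R :=
  fun w => fine (mu (cyl S w)) / fine (nu (cyl S w)).

Definition cyl_dominated mu nu S : Prop :=
  forall w, fine (nu (cyl S w)) = 0 -> fine (mu (cyl S w)) = 0.

Lemma cyl_prob_ge0 mu S w : 0 <= fine (mu (cyl S w)).
Proof. exact: fine_ge0. Qed.

Lemma density_ge0 mu nu S w : 0 <= density mu nu S w.
Proof. by rewrite divr_ge0 ?cyl_prob_ge0. Qed.

Lemma density_depends mu nu S : depends_on [set` S] (density mu nu S).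
Proof.
move=> w s ws; rewrite /density; have -> // : cyl S w = cyl S s.
by apply: esym; apply: eq_cyl => x xS; rewrite ws.
Qed.

Lemma density_mul mu nu S w : cyl_dominated mu nu S ->
  density mu nu S w * fine (nu (cyl S w)) = fine (mu (cyl S w)).
Proof.
move=> dom; rewrite /density; have [n0|n0] := eqVneq (fine (nu (cyl S w))) 0.
  by rewrite n0 mulr0 dom.
by rewrite divfK.
Qed.

Lemma avg_density mu nu S f : cyl_dominated mu nu S -> depends_on [set` S] f ->
  \int[nu]_s (density mu nu S s * f s) = \int[mu]_s f s.
Proof.
move=> dom df; have dd := @density_depends mu nu S.
rewrite (@avg_depends1 _ _ _ _ nu S); last exact: (depends_comp2 (fun x y => x * y)).
rewrite (avg_depends1 mu df); apply: eq_bigr => p _.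
by rewrite mulrAC density_mul // mulrC.
Qed.

Variable g : kernel_family R L E.
Hypothesis gs : is_specification g.
Hypothesis gm : monotonicity_preserving g.

(** Given the spins in [D], which are disjoint from [Lam], every large finite
    volume kernel may be resampled in [Lam], and freezing then raises the result.
    Since [v] is only required to be nonnegative, it may be a density. *)
Lemma avg_le_frozen c mu b Lam D S f v : volume_limit g (extreme c) mu ->
  depends_on [set` D] v -> [disjoint D & Lam]%fset -> (forall w, 0 <= v w) ->
  local_fun f -> monotone b f ->
  \int[mu]_s (v s * f s) <= \int[mu]_s (v s * frozen g b Lam f S s).
Proof.
move=> muE dv DL v0 lf mf; have lv := depends_local dv.
have bf := local_bm lf; have bv := local_bm lv.
have lb := @local_frozen R L disp E g b Lam f S.
have lvf : local_fun (fun s => v s * f s) := local_comp2 (fun x y => x * y) lv lf.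
have lvb : local_fun (fun s => v s * frozen g b Lam f S s) :=
  local_comp2 (fun x y => x * y) lv lb.
apply: (totally_le (T := Lam) (muE _ lvf) (muE _ lvb)) => V LV.
rewrite -(kapp_consistent gs _ LV lvf); apply: avg_le; first exact: (bm_kapp gs).
  exact: local_bm.
move=> s; rewrite (kapp_pull gs) //; last first.
  apply: dependsS dv => x /= xD xL.
  by move/fdisjointP: DL => /(_ x xD); rewrite xL.
by rewrite ler_wpM2l //; apply: (kapp_le_frozen gm).
Qed.

(** [v] does not see [Lam], so that it passes through the kernel of [Lam], and
    once [S] contains [D] it does not notice the freezing either. *)
Lemma avg_frozen_cvg mu b Lam D f v : volume_limit g (extreme b) mu ->
  depends_on [set` D] v -> [disjoint D & Lam]%fset -> local_fun f ->
  \int[mu]_s (v s * frozen g b Lam f S s) @[S --> totally] -->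
    (\int[mu]_s (v s * f s) : R).
Proof.
move=> muE dv DL lf; have lv := depends_local dv.
have lvf : local_fun (fun s => v s * f s) := local_comp2 (fun x y => x * y) lv lf.
apply: (totally_eq (T := D) (volume_limit_frozen_cvg gs gm Lam muE lvf)) => S DS.
apply: eq_Rintegral => s _; rewrite /frozen (kapp_pull gs); last 3 first.
- apply: dependsS dv => x /= xD xL.
  by move/fdisjointP: DL => /(_ x xD); rewrite xL.
- exact: local_bm.
- exact: local_bm.
congr (_ * _); apply: dv => x xD; rewrite splice_in //.
exact: (fsubsetP DS).
Qed.

(** The Markov property: conditionally on the cylinder, the law off [D] is the
    kernel of the remaining volume with the spins in [D] as boundary values. *)
Lemma kapp_cyl_mul D V s th h : (D `<=` V)%fset -> local_fun h ->
  kapp g V (fun t => \1_(cyl D s) t * h t) th =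
  kapp g V (\1_(cyl D s)) th * kapp g (V `\` D)%fset h (splice D s th).
Proof.
move=> DV lh; have lc := @local_cyl L disp E R D s.
have lch : local_fun (fun t => \1_(cyl D s) t * h t) :=
  local_comp2 (fun x y => x * y) lc lh.
rewrite -(kapp_consistent gs th (fsubsetDl V D) lch).
rewrite mulrC /kapp -avg_scale; last exact: bm_cyl.
apply: (avg_ae (measurable_off V th) (spec_off gs V th)).
- exact: (bm_kapp gs).
- by apply: bm_mul; [exact: bm_cst|exact: bm_cyl].
move=> t tth; rewrite -/(kapp g _ _ _) (kapp_pull gs); last 3 first.
- apply: dependsS (@depends_cyl _ _ _ _ D s) => x /= xD.
  by rewrite inE xD.
- exact: bm_cyl.
- exact: local_bm.
rewrite mulrC indicE; case: (boolP (t \in cyl D s)); last by rewrite !mulr0.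
rewrite inE => tC; rewrite !mulr1; apply: (kapp_depends gs) => x /=.
rewrite inE => /negP; rewrite negb_and negbK /splice.
by case: ifPn => [xD _|_ /= xV]; [exact: tC|exact: tth].
Qed.

(** Conditionally on the spins in [D], the two finite volume measures are kernels
    of the same volume with ordered boundary values. The inequality is stated
    without quotients, so that it survives the limit also for null cylinders. *)
Lemma cyl_domination b mu nu D s h :
  volume_limit g (extreme (~~ b)) mu -> volume_limit g (extreme b) nu ->
  local_fun h -> monotone b h ->
  (\int[mu]_t (\1_(cyl D s) t * h t)) * fine (nu (cyl D s)) <=
  (\int[nu]_t (\1_(cyl D s) t * h t)) * fine (mu (cyl D s)).
Proof.
move=> muE nuE lh mh; have lc := @local_cyl L disp E R D s.
have lch : local_fun (fun t => \1_(cyl D s) t * h t) :=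
  local_comp2 (fun x y => x * y) lc lh.
rewrite -!avg_cyl.
apply: (totally_le (T := D) (cvgM (muE _ lch) (nuE _ lc)) (cvgM (nuE _ lch) (muE _ lc))).
move=> V DV /=; rewrite !kapp_cyl_mul // mulrAC [leRHS]mulrAC.
rewrite [kapp g V _ _ * kapp g V _ _]mulrC.
apply: ler_wpM2l.
  by rewrite mulr_ge0 // /kapp avg_cyl cyl_prob_ge0.
apply: (@kapp_monotone R L disp E g b _ h gm (local_bm lh) mh).
exact: splice_extremes.
Qed.

(** The right-hand side averages [h] when the spins in [D] are drawn from [mu] and
    the other ones, given these, from [nu]; the domination above is used on
    each cylinder. *)
Lemma avg_le_density b mu nu D h :
  volume_limit g (extreme (~~ b)) mu -> volume_limit g (extreme b) nu ->
  cyl_dominated mu nu D -> local_fun h -> monotone b h ->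
  \int[mu]_s h s <= \int[nu]_s (density mu nu D s * h s).
Proof.
move=> muE nuE dom lh mh; have bh := local_bm lh.
rewrite (avg_depends nu (@density_depends mu nu D) bh).
rewrite -(_ : \int[mu]_s (1 * h s) = \int[mu]_s h s); last first.
  by apply: eq_Rintegral => s _; rewrite mul1r.
rewrite (@avg_depends _ _ _ _ mu D (fun=> 1)) //.
apply: ler_sum => p _; rewrite mul1r.
have := cyl_domination D (extend p) muE nuE lh mh.
have := dom (extend p); rewrite /density.
set c := \int[mu]_s _; set e := \int[nu]_s _.
have [n0 /(_ n0) m0 _|n0 _ dle] := eqVneq (fine (nu (cyl D (extend p)))) 0.
  rewrite n0 invr0 mulr0 mul0r.
  have [_ [M hM]] := bh.
  have : c <= \int[mu]_s (M * \1_(cyl D (extend p)) s).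
    apply: avg_le.
    - by apply: bm_mul => //; exact: bm_cyl.
    - by apply: bm_mul; [exact: bm_cst|exact: bm_cyl].
    - move=> s; rewrite mulrC ler_wpM2r // ?indicE //.
      exact: le_trans (ler_norm _) (hM s).
  by rewrite avg_scale ?avg_cyl ?m0 ?mulr0 //; exact: bm_cyl.
rewrite mulrAC ler_pdivlMr ?[_ * e]mulrC //.
by rewrite lt_neqAle eq_sym n0 cyl_prob_ge0.
Qed.

End Densities.

(** * Relative entropy against total variation, pointwise *)

Section Pointwise.
Context (R : realType).
Implicit Types (u v t : R).

(** A pointwise form of the comparison of relative entropy with the Hellinger
    distance; it comes from [ln x <= x - 1] at [x = sqrt v / sqrt u]. *)
Lemma entropy_ge_hellinger u v : 0 <= u -> 0 <= v -> (v = 0 -> u = 0) ->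
  (Num.sqrt u - Num.sqrt v) ^+ 2 <= u * ln u - u * ln v - u + v.
Proof.
move=> u0 v0 uv; have [->|un0] := eqVneq u 0.
  by rewrite sqrtr0 !mul0r !subr0 sub0r sqrrN sqr_sqrtr // add0r.
have up : 0 < u by rewrite lt_neqAle eq_sym un0.
have vp : 0 < v.
  by rewrite lt_neqAle eq_sym v0 andbT; apply: contra_neq un0.
set a := Num.sqrt u; set c := Num.sqrt v.
have ap : 0 < a by rewrite sqrtr_gt0.
have cp : 0 < c by rewrite sqrtr_gt0.
have uE : u = a ^+ 2 by rewrite sqr_sqrtr.
have vE : v = c ^+ 2 by rewrite sqr_sqrtr.
have lnr : ln c - ln a <= c / a - 1.
  rewrite -ln_div ?posrE //.
  have := @le_ln1Dx R (c / a - 1); rewrite addrCA subrr addr0; apply.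
  by rewrite ltrBrDl subrr divr_gt0.
have : a ^+ 2 * (ln c - ln a) <= a ^+ 2 * (c / a - 1) by rewrite ler_wpM2l // sqr_ge0.
have -> : a ^+ 2 * (c / a - 1) = a * c - a ^+ 2 by field; rewrite gt_eqF.
clearbody a c; rewrite uE vE (lnXn 2 ap) (lnXn 2 cp) -subr_ge0 => h; rewrite -subr_ge0.
rewrite (_ : _ - _ = 2 * (a * c - a ^+ 2 - a ^+ 2 * (ln c - ln a))).
  exact: mulr_ge0.
by ring.
Qed.

Lemma dist_sqr_le a c t : 0 <= a -> 0 <= c -> 0 < t ->
  `|a ^+ 2 - c ^+ 2| <= (a - c) ^+ 2 / (2 * t) + t * (a ^+ 2 + c ^+ 2).
Proof.
move=> a0 c0 t0; have tn0 : t != 0 by rewrite gt_eqF.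
have -> : (a - c) ^+ 2 / (2 * t) + t * (a ^+ 2 + c ^+ 2) =
   ((a - c) ^+ 2 + 2 * t ^+ 2 * (a ^+ 2 + c ^+ 2)) / (2 * t) by field.
rewrite ler_pdivlMr ?mulr_gt0 // subr_sqr normrM (ger0_norm (addr_ge0 a0 c0)).
rewrite -subr_ge0.
rewrite (_ : _ - _ = (`|a - c| - t * (a + c)) ^+ 2 + t ^+ 2 * (a - c) ^+ 2).
  by apply: addr_ge0; [|apply: mulr_ge0]; exact: sqr_ge0.
rewrite -[X in X + 2 * _ * _ - _]real_normK ?num_real //.
by move: `|a - c| => z; ring.
Qed.

(** The parameter [t] replaces the Cauchy-Schwarz inequality in the proof of
    Pinsker's inequality: after integration one optimizes over [t] instead of
    handling square roots of integrals. *)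
Lemma dist_le_entropy u v t : 0 <= u -> 0 <= v -> (v = 0 -> u = 0) -> 0 < t ->
  `|u - v| <= (u * ln u - u * ln v - u + v) / (2 * t) + t * (u + v).
Proof.
move=> u0 v0 uv t0; have h := entropy_ge_hellinger u0 v0 uv.
have := dist_sqr_le (sqrtr_ge0 u) (sqrtr_ge0 v) t0.
rewrite (sqr_sqrtr u0) (sqr_sqrtr v0) => /le_trans; apply.
by rewrite lerD2r ler_wpM2r // invr_ge0 mulr_ge0 // ltW.
Qed.

End Pointwise.

(** * Relative entropy on finite volumes *)

Section Entropy.
Context (R : realType) (L : countType) (disp : Order.disp_t)
  (E : finTBOrderType disp).
Notation Omega := (config L E).
Implicit Types (S T V W D Lam : {fset L}) (w s t th : Omega)
  (f h v : Omega -> R).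
Variables mu nu : probability Omega R.

(** The integrand vanishes where the density does, since [ln 0] is a real
    number. *)
Definition entropy S : R :=
  \int[nu]_s (density mu nu S s * ln (density mu nu S s)).

Notation dens := (density mu nu).
Notation dominated := (cyl_dominated mu nu).

Lemma cyl_probS (rho : probability Omega R) S T w : (S `<=` T)%fset ->
  fine (rho (cyl T w)) <= fine (rho (cyl S w)).
Proof.
move=> ST; rewrite -lee_fin -!prob_fin; try exact: measurable_cyl.
apply: le_measure; rewrite ?inE; try exact: measurable_cyl.
exact: cylS.
Qed.

Lemma dominatedS S T : (S `<=` T)%fset -> dominated T -> dominated S.
Proof.
move=> ST dom w n0.
rewrite -avg_cyl (@avg_depends1 _ _ _ _ mu T); last first.
  apply: dependsS (@depends_cyl _ _ _ _ S w) => x; exact: (fsubsetP ST).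
apply: big1 => p _; rewrite indicE; case: (boolP (_ \in _)); last by rewrite mul0r.
rewrite inE mul1r => pw; apply: dom; apply/eqP; rewrite eq_le cyl_prob_ge0 andbT.
rewrite -n0 -(eq_cyl pw); exact: cyl_probS.
Qed.

Lemma density_eq0 S T w : (S `<=` T)%fset -> dominated T ->
  dens S w = 0 -> dens T w = 0.
Proof.
move=> ST dom d0; rewrite /density.
suff -> : fine (mu (cyl T w)) = 0 by rewrite mul0r.
apply/eqP; rewrite eq_le cyl_prob_ge0 andbT.
rewrite (le_trans (cyl_probS mu w ST)) //.
by rewrite -(density_mul w (dominatedS ST dom)) d0 mul0r.
Qed.

Lemma local_density S : local_fun (dens S).
Proof. exact: depends_local (@density_depends _ _ _ _ mu nu S). Qed.

Lemma avg_density_ln S T : (S `<=` T)%fset -> dominated T ->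
  \int[nu]_s (dens T s * ln (dens S s)) = entropy S.
Proof.
move=> ST dom; have dS := depends_comp (@ln R) (@density_depends _ _ _ _ mu nu S).
rewrite (avg_density dom); last by apply: dependsS dS => x; exact: (fsubsetP ST).
by rewrite -(avg_density (dominatedS ST dom) dS).
Qed.

Lemma avg_density1 S : dominated S -> \int[nu]_s dens S s = 1.
Proof.
move=> dom; rewrite -(avg_cst mu 1) -(avg_density dom) //.
by apply: eq_Rintegral => s _; rewrite mulr1.
Qed.

(** The last two terms have opposite integrals; they make the function
    nonnegative at every point. *)
Definition entropy_gap S T : Omega -> R := fun s =>
  dens T s * ln (dens T s) - dens T s * ln (dens S s) - dens T s + dens S s.

Lemma avg_entropy_gap S T : (S `<=` T)%fset -> dominated T ->
  bounded_measurable (entropy_gap S T) /\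
  \int[nu]_s entropy_gap S T s = entropy T - entropy S.
Proof.
move=> ST dom; have domS := dominatedS ST dom.
have bT : bounded_measurable (dens T) := local_bm (local_density T).
have bS : bounded_measurable (dens S) := local_bm (local_density S).
have bl V : bounded_measurable (fun s => ln (dens V s)).
  exact/local_bm/(local_comp (@ln R))/local_density.
have b1 := bm_mul bT (bl T); have b2 := bm_mul bT (bl S).
have b3 := bm_sub b1 b2; have b4 := bm_sub b3 bT.
split; first exact: bm_add.
rewrite avg_add // !avg_sub // (avg_density_ln ST dom) !avg_density1 //.
by rewrite subrK.
Qed.

Lemma entropy_le S T : (S `<=` T)%fset -> dominated T -> entropy S <= entropy T.
Proof.
move=> ST dom; have [bg Eg] := avg_entropy_gap ST dom.
rewrite -subr_ge0 -Eg; apply: Rintegral_ge0 => s _.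
apply: le_trans (entropy_ge_hellinger _ _ _); first exact: sqr_ge0.
- exact: density_ge0.
- exact: density_ge0.
- exact: density_eq0 ST dom.
Qed.

Lemma entropy0 : entropy fset0 = 0.
Proof.
rewrite /entropy -[RHS](avg_cst nu 0); apply: eq_Rintegral => s _.
rewrite /density (_ : cyl fset0 s = setT); last by apply/seteqP; split.
by rewrite !probability_setT /= divr1 ln1 mulr0.
Qed.

Lemma entropy_ge0 T : dominated T -> 0 <= entropy T.
Proof. by move=> dom; rewrite -entropy0; apply: entropy_le. Qed.

(** Replacing the density on [T] by the one on [S] costs little in total
    variation when the entropy gap is small. *)
Lemma entropy_estimate S T f (M t : R) : (S `<=` T)%fset -> dominated T ->
  depends_on [set` T] f -> 0 < t -> (forall s, `|f s| <= M) ->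
  `|\int[mu]_s f s - \int[nu]_s (dens S s * f s)| <=
    M * ((entropy T - entropy S) / (2 * t) + t * 2).
Proof.
move=> ST dom df t0 fM; have [bg Eg] := avg_entropy_gap ST dom.
have bT : bounded_measurable (dens T) := local_bm (local_density T).
have bS : bounded_measurable (dens S) := local_bm (local_density S).
have bf : bounded_measurable f := local_bm (depends_local df).
rewrite -(avg_density dom df) -avg_sub; try exact: bm_mul.
have bB : bounded_measurable (fun s =>
    M * (entropy_gap S T s / (2 * t) + t * (dens T s + dens S s))).
  apply: bm_mul; first exact: bm_cst.
  apply: bm_add; first by apply: bm_mul => //; exact: bm_cst.
  by apply: bm_mul; [exact: bm_cst|exact: bm_add].
apply: (@le_trans _ _ (\int[nu]_s
    (M * (entropy_gap S T s / (2 * t) + t * (dens T s + dens S s))))).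
  have point s : `|dens T s * f s - dens S s * f s| <=
      M * (entropy_gap S T s / (2 * t) + t * (dens T s + dens S s)).
    rewrite -mulrBl normrM mulrC ler_pM //.
    apply: dist_le_entropy => //; try exact: density_ge0.
    exact: density_eq0 ST dom.
  have bd := bm_sub (bm_mul bT bf) (bm_mul bS bf).
  rewrite ler_norml -avg_opp //; apply/andP; split; apply: avg_le => //.
  - exact: bm_opp.
  - by move=> s; have := point s; rewrite ler_norml => /andP[].
  - by move=> s; have := point s; rewrite ler_norml => /andP[].
rewrite avg_scale; last first.
  apply: bm_add; first by apply: bm_mul => //; exact: bm_cst.
  by apply: bm_mul; [exact: bm_cst|exact: bm_add].
rewrite avg_add; last 2 first.
- by apply: bm_mul => //; exact: bm_cst.
- by apply: bm_mul; [exact: bm_cst|exact: bm_add].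
rewrite avg_scale; last exact: bm_add.
rewrite avg_add // !avg_density1 //; last exact: dominatedS ST dom.
under eq_Rintegral => s _ do rewrite mulrC.
by rewrite avg_scale // Eg [_^-1 * _]mulrC.
Qed.

End Entropy.

(** * Translations and the entropy of large cubes *)

Section Translation.
Context (R : realType) (d : nat) (L : countType) (act : 'rV[int]_d -> L -> L)
  (disp : Order.disp_t) (E : finTBOrderType disp).
Hypothesis act_action : transitive_action act.
Notation Omega := (config L E).
Notation totally := summability.totally.
Implicit Types (S T V W D Lam : {fset L}) (w s t th : Omega)
  (mu nu : probability Omega R) (f h v : Omega -> R) (i j : 'rV[int]_d).

Notation tau := (translate act).

Definition shift i S : {fset L} := [fset act i x | x in S]%fset.

Lemma actNK i x : act (- i) (act i x) = x.
Proof. by rewrite -(actD act_action) addNr (act0 act_action). Qed.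

Lemma actKN i x : act i (act (- i) x) = x.
Proof. by rewrite -(actD act_action) subrr (act0 act_action). Qed.

Lemma act_inj i : injective (act i).
Proof. exact: can_inj (actNK i). Qed.

Lemma mem_shift i S x : (act i x \in shift i S) = (x \in S).
Proof. by rewrite mem_imfset //; exact: act_inj. Qed.

Lemma mem_shiftE i S x : (x \in shift i S) = (act (- i) x \in S).
Proof. by rewrite -{1}(actKN i x) mem_shift. Qed.

Lemma shiftNK i S : shift (- i) (shift i S) = S.
Proof. by apply/fsetP => x; rewrite !mem_shiftE opprK actNK. Qed.

Lemma shiftKN i S : shift i (shift (- i) S) = S.
Proof. by apply/fsetP => x; rewrite !mem_shiftE opprK actKN. Qed.

Lemma shift_sub i S T : (S `<=` T)%fset -> (shift i S `<=` shift i T)%fset.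
Proof.
by move=> /fsubsetP ST; apply/fsubsetP => x; rewrite !mem_shiftE; apply: ST.
Qed.

Lemma shiftD i S T : shift i (S `\` T)%fset = (shift i S `\` shift i T)%fset.
Proof. by apply/fsetP => x; rewrite !inE !mem_shiftE inE. Qed.

Lemma translateK i w : tau i (tau (- i) w) = w.
Proof. by apply/funext => x; rewrite /translate opprK actKN. Qed.

Lemma preimage_cyl i S w :
  tau i @^-1` cyl S w = cyl (shift (- i) S) (tau (- i) w).
Proof.
apply/seteqP; split=> [s h y|s h x xS] /=.
  by rewrite mem_shiftE opprK => /h; rewrite /translate opprK actNK => ->.
have := h (act (- i) x); rewrite mem_shift /translate opprK actKN.
exact.
Qed.

Lemma invariant_cyl mu i S w : invariant_measure act mu ->
  mu (cyl (shift i S) (tau i w)) = mu (cyl S w).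
Proof.
move=> inv; rewrite -(inv (- i) (cyl S w) (measurable_cyl S w)).
by rewrite preimage_cyl opprK.
Qed.

Lemma avg_translate mu i f : invariant_measure act mu -> local_fun f ->
  \int[mu]_s f (tau i s) = \int[mu]_s f s.
Proof.
move=> inv [S df]; rewrite [RHS](avg_depends1 _ df).
under eq_Rintegral => s _ do rewrite (depends_sum _ df).
have tE p s : \1_(cyl S (extend p)) (tau i s) =
    \1_(tau i @^-1` cyl S (@extend L disp E S p)) s :> R.
  by rewrite !indicE; congr ((_ : bool)%:R); apply/idP/idP; rewrite !inE.
have mt (p : pattern E S) : measurable (tau i @^-1` cyl S (extend p)).
  by rewrite preimage_cyl; exact: measurable_cyl.
rewrite avg_sum; last first.
  move=> p; apply: bm_mul; first exact: bm_cst.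
  under eq_fun do rewrite tE.
  exact: bm_indic.
apply: eq_bigr => p _; rewrite avg_scale; last first.
  under eq_fun do rewrite tE.
  exact: bm_indic.
congr (_ * _); under eq_Rintegral => s _ do rewrite tE.
by rewrite avg_indic // inv //; exact: measurable_cyl.
Qed.

(** Translating a finite volume kernel amounts to translating its volume, as the
    extreme configurations are constant, and the translates of the finite
    volumes are again cofinal. *)
Lemma volume_limit_invariant (g : kernel_family R L E) b mu :
  invariant_spec act g -> volume_limit g (extreme b) mu ->
  invariant_measure act mu.
Proof.
move=> ginv muE i.
suff h (A : set Omega) : measurable A ->
    measurable (tau i @^-1` A) /\ mu (tau i @^-1` A) = mu A.
  by move=> A mA; have [] := h A mA.
move: A; apply: sigma_coord_ind => [|S w _|A mA [mtA IH]|F mF tF IH].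
- by rewrite preimage_set0.
- have mt : measurable (tau i @^-1` cyl S w).
    by rewrite preimage_cyl; exact: measurable_cyl.
  split => //; rewrite prob_fin // [RHS]prob_fin; last exact: measurable_cyl.
  congr EFin; rewrite -!avg_indic //; last exact: measurable_cyl.
  have c1 := muE _ (@local_cyl L disp E R S w).
  have lt : local_fun (\1_(tau i @^-1` cyl S w) : Omega -> R).
    by rewrite preimage_cyl; exact: local_cyl.
  have sc : shift (- i) V @[V --> totally] --> totally.
    move=> P [T _ hT]; exists (shift i T) => // V /= TV; apply: hT => /=.
    by rewrite -(shiftNK i T); apply: shift_sub.
  have c2 := @cvg_comp _ _ _ (shift (- i)) (fun V => kapp g V _ (extreme b))
    _ _ _ sc (muE _ lt).
  have c3 : kapp g (shift (- i) V) (\1_(tau i @^-1` cyl S w)) (extreme b)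
      @[V --> totally] --> (\int[mu]_s \1_(cyl S w) s : R).
    apply: (totally_eq (T := fset0) c1) => V _.
    rewrite /kapp !avg_indic //; last exact: measurable_cyl.
    rewrite -(ginv i V (extreme b) _ (measurable_cyl S w)).
    by rewrite (_ : tau (- i) (extreme b) = extreme b).
  exact: (cvg_unique _ c2 c3).
- rewrite preimage_setC; split; first exact: measurableC.
  by rewrite !probability_setC // ?IH //.
- rewrite preimage_bigcup.
  have mF' n : measurable (F n) by exact: mF.
  have mt n : measurable (tau i @^-1` F n) by have [] := IH n.
  split; first exact: bigcupT_measurable.
  rewrite !measure_semi_bigcup //.
  + by apply: eq_eseriesr => n _; have [] := IH n.
  + exact: bigcupT_measurable.
  + by apply/trivIsetP => m n _ _ mn; rewrite -preimage_setI
      (trivIsetP.1 tF m n) ?preimage_set0.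
  + exact: bigcupT_measurable.
Qed.

Lemma cube_shift i x n : cube act (act i x) n = shift i (cube act x n).
Proof.
apply/fsetP => y; rewrite mem_shiftE; apply/idP/idP => /in_cube[k kn yE];
  apply/in_cube; exists k => //.
  by rewrite yE -!(actD act_action) addrAC addNr add0r.
rewrite -[LHS](actKN i) yE -!(actD act_action); congr (act _ x).
by rewrite addrC.
Qed.

Definition vectors n : nat := #|{ffun 'I_d -> 'I_(n.*2.+1)}|.

Lemma card_cube x n : (#|` cube act x n| <= vectors n)%N.
Proof.
apply: leq_trans (leq_imfset_card _ _ _) _.
by rewrite /vectors cardE /enum_finmem /= enumT.
Qed.

Lemma cube_center x n : x \in cube act x n.
Proof.
apply/in_cube; exists 0; last by rewrite oppr0 (act0 act_action).
by move=> j; rewrite mxE normr0.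
Qed.

Lemma cube_trans x y z m n : y \in cube act x m -> z \in cube act y n ->
  z \in cube act x (m + n).
Proof.
move=> /in_cube[i im ->] /in_cube[j jn ->]; apply/in_cube; exists (i + j).
  by move=> k; rewrite mxE PoszD (le_trans (ler_normD _ _)) // lerD.
by rewrite -(actD act_action) opprD addrC.
Qed.

Lemma cube_sym x y n : y \in cube act x n -> x \in cube act y n.
Proof.
move=> /in_cube[i im ->]; apply/in_cube; exists (- i).
  by move=> k; rewrite mxE normrN.
by rewrite actNK.
Qed.

(** Each coordinate of the translation vector is truncated to [[-m, m]]; the
    remainder is then at most [n] in absolute value. *)
Lemma cube_split x z m n : z \in cube act x (m + n) ->
  exists2 y, y \in cube act x m & z \in cube act y n.
Proof.
move=> /in_cube[i imn ->].
pose c (a : int) : int := if a < - m%:Z then - m%:Z else if m%:Z < a then m%:Z else a.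
pose j : 'rV[int]_d := \row_k c (i 0 k).
exists (act (- j) x).
  apply/in_cube; exists j => // k; rewrite mxE /c.
  by move: (i 0 k) => a; case: ltP => ?; [|case: ltP => ?]; lia.
apply/in_cube; exists (i - j).
  move=> k; rewrite !mxE /c; move: (imn k); move: (i 0 k) => a ?.
  by case: ltP => ?; [|case: ltP => ?]; lia.
by rewrite -(actD act_action) opprB addrAC subrr add0r.
Qed.

Lemma card_cubeD x m n :
  (#|` cube act x (m + n)| <= #|` cube act x m| * vectors n)%N.
Proof.
have sub : (cube act x (m + n) `<=` \bigcup_(y <- cube act x m) cube act y n)%fset.
  apply/fsubsetP => z /cube_split[y yx zy].
  by apply/bigfcupP; exists y; rewrite ?andbT.
apply: leq_trans (fsubset_leq_card sub) _.
rewrite -[X in (_ <= X * _)%N]sum1_size big_distrl /=.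
apply: (big_ind2 (fun A k => #|` A| <= k)%N).
- by rewrite cardfs0.
- move=> A a B c Aa Bc; rewrite (leq_trans _ (leq_add Aa Bc)) //.
  by rewrite cardfsU leq_subr.
- by move=> y _; rewrite mul1n card_cube.
Qed.

Lemma cube_mono o m n : (m <= n)%N -> (cube act o m `<=` cube act o n)%fset.
Proof.
move=> mn; apply/fsubsetP => x /in_cube[i im ->]; apply/in_cube; exists i => // j.
by rewrite (le_trans (im j)) // lez_nat.
Qed.

Lemma cube_exhaust o S : exists N, (S `<=` cube act o N)%fset.
Proof.
suff [N hN] : exists N, forall x, x \in (S : seq L) -> x \in cube act o N.
  by exists N; apply/fsubsetP.
elim: (S : seq L) => [|x r [N IH]]; first by exists 0%N.
have [i xE] := act_trans act_action o x.
pose M := (\sum_(j < d) absz (i ord0 j))%N.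
exists (M + N)%N => y; rewrite inE => /orP[/eqP ->|/IH].
  apply/in_cube; exists (- i); last by rewrite opprK.
  move=> j; rewrite mxE normrN -abszE lez_nat (leq_trans _ (leq_addr _ _)) //.
  by rewrite /M (bigD1 j) //= leq_addr.
by apply: (fsubsetP (cube_mono _ _)); rewrite leq_addl.
Qed.

Section Entropies.
Variables mu nu : probability Omega R.
Hypothesis mu_inv : invariant_measure act mu.
Hypothesis nu_inv : invariant_measure act nu.
Notation dominated := (cyl_dominated mu nu).
Notation ent := (entropy mu nu).

Lemma density_shift i S w :
  density mu nu (shift i S) (tau i w) = density mu nu S w.
Proof. by rewrite /density !invariant_cyl. Qed.

Lemma dominated_shift i S : dominated S -> dominated (shift i S).
Proof.
by move=> dom w; rewrite -{1 2}(translateK i w) !invariant_cyl //; apply: dom.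
Qed.

Lemma entropy_shift i S : ent (shift i S) = ent S.
Proof.
rewrite /entropy -(@avg_translate nu i _ nu_inv); last first.
  exact: (local_comp (fun x => x * ln x) (local_density mu nu (shift i S))).
by apply: eq_Rintegral => s _; rewrite density_shift.
Qed.

Variables (o : L) (Lam : {fset L}) (N : nat) (delta : R).
Hypothesis delta0 : 0 < delta.
Hypothesis LamN : (Lam `<=` cube act o N)%fset.
Hypothesis gap : forall W, (cube act o N `<=` W)%fset -> dominated W ->
  delta <= ent W - ent (W `\` Lam)%fset.

Lemma gap_shift i W : (cube act (act i o) N `<=` W)%fset -> dominated W ->
  delta <= ent W - ent (W `\` shift i Lam)%fset.
Proof.
move=> NW dom; pose V := shift (- i) W.
have -> : W = shift i V by rewrite shiftKN.
rewrite -shiftD (entropy_shift i V) (entropy_shift i (V `\` Lam)%fset).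
apply: gap.
  by rewrite -(shiftNK i (cube act o N)) -cube_shift; apply: shift_sub.
exact: dominated_shift.
Qed.

(** A greedy packing. Removing the translate of [Lam] attached to a point [x] of
    [X] lowers the entropy by [delta], and leaves intact the cubes around the
    points of [X] that are not within [N + N] of [x]; at most
    [vectors (N + N)] points are lost in this way. *)
Lemma entropy_packing X W : dominated W ->
  (forall x, x \in X -> (cube act x N `<=` W)%fset) ->
  delta * #|` X|%:R <= ent W * (vectors (N + N))%:R.
Proof.
have [k] := ubnP #|` X|; elim: k X W => // k IH X W Xk dom XW.
have [->|[x xX]] := fset_0Vmem X.
  by rewrite cardfs0 mulr0 mulr_ge0 // entropy_ge0.
have [i xE] := act_trans act_action o x.
pose W' := (W `\` shift i Lam)%fset; pose X' := (X `\` cube act x (N + N))%fset.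
have W'W : (W' `<=` W)%fset by exact: fsubsetDl.
have XW' y : y \in X' -> (cube act y N `<=` W')%fset.
  rewrite inE => /andP[nyx yX]; apply/fsubsetP => z zy.
  rewrite inE (fsubsetP (XW y yX)) // andbT.
  apply: contra nyx => zL; apply: (@cube_trans x z y N N); last exact: cube_sym.
  by rewrite -xE cube_shift; apply: (fsubsetP (shift_sub i LamN)).
have X'X : (#|` X'| < #|` X|)%N.
  apply: fproper_ltn_card; rewrite fproperE fsubsetDl /=.
  by apply/fsubsetPn; exists x => //; rewrite inE cube_center.
have := IH X' W' (leq_trans X'X _) (dominatedS W'W dom) XW'.
rewrite -ltnS => /(_ Xk) h.
have g : delta <= ent W - ent W' by apply: gap_shift => //; rewrite xE; apply: XW.
have cX : (#|` X| <= #|` X'| + vectors (N + N))%N.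
  rewrite -(cardfsID (cube act x (N + N)) X) addnC leq_add2l.
  by rewrite (leq_trans _ (card_cube x _)) // fsubset_leq_card // fsubsetIr.
have K0 : 0 <= (vectors (N + N))%:R :> R by [].
have {}cX : (#|` X|%:R : R) <= #|` X'|%:R + (vectors (N + N))%:R.
  by rewrite -natrD ler_nat.
apply: (@le_trans _ _ (delta * (#|` X'|%:R + (vectors (N + N))%:R))).
  by rewrite ler_wpM2l // ltW.
apply: (@le_trans _ _ ((ent W' + delta) * (vectors (N + N))%:R)).
  by rewrite mulrDr mulrDl lerD2r.
by rewrite ler_wpM2r // -lerBrDl.
Qed.

End Entropies.

(** If all the gaps were at least [delta], the entropy of a cube would grow at
    least proportionally to its cardinality, by packing a slightly smaller cube:
    this contradicts the hypothesis of zero density. *)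
Lemma small_entropy_gap mu nu o : invariant_measure act mu ->
  invariant_measure act nu ->
  (forall e N, 0 < e -> exists2 n, (N <= n)%N &
     cyl_dominated mu nu (cube act o n) /\
     entropy mu nu (cube act o n) < e * #|` cube act o n|%:R) ->
  forall S Lam delta, 0 < delta -> exists W,
    [/\ (S `<=` W)%fset, (Lam `<=` W)%fset, cyl_dominated mu nu W &
        entropy mu nu W - entropy mu nu (W `\` Lam)%fset < delta].
Proof.
move=> mu_inv nu_inv zero S Lam delta d0.
have [N hN] := cube_exhaust o (S `|` Lam)%fset.
have SN : (S `<=` cube act o N)%fset by apply: fsubset_trans hN; exact: fsubsetUl.
have LN : (Lam `<=` cube act o N)%fset by apply: fsubset_trans hN; exact: fsubsetUr.
apply: contrapT => nW.
have gap W : (cube act o N `<=` W)%fset -> cyl_dominated mu nu W ->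
    delta <= entropy mu nu W - entropy mu nu (W `\` Lam)%fset.
  move=> NW dom; rewrite leNgt; apply/negP => h; apply: nW; exists W.
  by split => //; apply: fsubset_trans NW.
pose K : R := (vectors (N + N))%:R; pose K2 : R := (vectors N)%:R.
have vec0 n : (0 < vectors n)%N.
  by apply: leq_trans (card_cube o n); rewrite cardfs_gt0; apply/fset0Pn;
    exists o; exact: cube_center.
have K0 : 0 < K by rewrite ltr0n.
have K20 : 0 < K2 by rewrite ltr0n.
(* The packing argument loses a factor [K], and replacing the cube of size [m]
   by the one of size [m - N] loses a factor [K2]. *)
have [|m Nm [dom small]] := zero (delta / (K * K2)) N.
  by rewrite divr_gt0 // mulr_gt0.
have mE : m = (m - N + N)%N by rewrite subnK.
have pack := @entropy_packing mu nu mu_inv nu_inv o Lam N delta d0 LN gap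
  (cube act o (m - N)) (cube act o m) dom.
have {}pack := pack _.
have cX := card_cubeD o (m - N) N; rewrite -mE in cX.
have {}cX : (#|` cube act o m|%:R : R) <= #|` cube act o (m - N)|%:R * K2.
  by rewrite -natrM ler_nat.
have h : delta * #|` cube act o (m - N)|%:R <= entropy mu nu (cube act o m) * K.
  apply: pack => x xc; apply/fsubsetP => z zx.
  by rewrite mE; apply: cube_trans xc zx.
have : entropy mu nu (cube act o m) * K < delta * #|` cube act o (m - N)|%:R.
  apply: (@lt_le_trans _ _ (delta / (K * K2) * #|` cube act o m|%:R * K)).
    by rewrite ltr_pM2r.
  have -> : delta / (K * K2) * #|` cube act o m|%:R * K =
      delta * (#|` cube act o m|%:R / K2).
    by field; rewrite !gt_eqF.
  by rewrite ler_pM2l // ler_pdivrMr.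
by rewrite ltNge h.
Qed.

End Translation.

(** * Relative entropy as a finite sum *)

Section RelativeEntropy.
Context (R : realType) (L : countType) (disp : Order.disp_t)
  (E : finTBOrderType disp).
Notation Omega := (config L E).
Implicit Types (S : {fset L}) (w s : Omega) (mu nu : probability Omega R).

Lemma restr_cyl S w : restr S @^-1` [set restr S w] = cyl S w.
Proof.
apply/seteqP; split=> [s /= h x xS|s h] /=.
  by have := congr1 (fun p => p (FSetSub xS)) h.
by apply/funext => -[x xS]; apply: h.
Qed.

Lemma measurable_pattern S (p : config S E) : measurable [set p].
Proof.
rewrite (_ : [set p] = cyl [fset x : S | true]%fset p).
  exact: measurable_cyl.
apply/seteqP; split=> [q -> //|q h] /=.
by apply/funext => x; apply: h; rewrite inE.
Qed.

Lemma marginal_pattern mu S w : marginal mu S [set restr S w] = mu (cyl S w).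
Proof. by rewrite -restr_cyl. Qed.

(** The Radon-Nikodym derivative of the marginals is only determined almost
    everywhere, but single patterns are measurable: it has to be the quotient of
    the probabilities on every pattern that [nu] charges. *)
Lemma rel_entropyE mu nu S : rel_entropy S mu nu != +oo%E ->
  cyl_dominated mu nu S /\ rel_entropy S mu nu = (entropy mu nu S)%:E.
Proof.
rewrite /rel_entropy; case: asboolP => [ac _|]; last by rewrite eqxx.
have dom : cyl_dominated mu nu S.
  move=> w n0; have /null_content_dominatesP h := ac.
  have h0 : marginal nu S [set restr S w] = 0%E.
    by rewrite marginal_pattern prob_fin ?n0 //; exact: measurable_cyl.
  have : marginal mu S [set restr S w] = 0%E := h _ (measurable_pattern _) h0.
  by rewrite marginal_pattern => ->.
split=> //.
set r := Radon_Nikodym _ _.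
have rE w : fine (r (restr S w)) * fine (nu (cyl S w)) = fine (mu (cyl S w)).
  have mp := measurable_pattern (restr S w).
  have h : marginal mu S [set restr S w] =
      (\int[marginal nu S]_(x in [set restr S w]) r x)%E.
    exact: (@Radon_Nikodym_integral _ _ _
      (charge_of_finite_measure (marginal mu S)) (marginal nu S) _ ac mp).
  rewrite (eq_integral (cst (r (restr S w)))) in h; last first.
    by move=> x; rewrite inE => ->.
  have rf : r (restr S w) \is a fin_num by exact: Radon_Nikodym_fin_num.
  rewrite -(fineK rf) integral_cst // in h.
  have mC := measurable_cyl S w.
  have h' : mu (cyl S w) = ((fine (r (restr S w)))%:E * nu (cyl S w))%E.
    by rewrite -!marginal_pattern; exact: h.
  by rewrite h' (prob_fin nu mC) -EFinM.
pose F w : R := fine (r (restr S w)) * ln (fine (r (restr S w))).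
have dF : depends_on [set` S] F.
  move=> w s ws; rewrite /F; have -> // : restr S w = restr S s.
  by apply/funext => -[x xS]; apply: ws.
rewrite (avg_EFin nu (local_bm (depends_local dF))); congr EFin.
rewrite /entropy (avg_depends1 nu dF) (@avg_depends1 _ _ _ _ nu S); last first.
  exact: (depends_comp (fun x => x * ln x) (@density_depends _ _ _ _ mu nu S)).
apply: eq_bigr => p _; rewrite /F.
have [->|n0] := eqVneq (fine (nu (cyl S (extend p)))) 0; first by rewrite !mulr0.
suff -> : fine (r (restr S (extend p))) = density mu nu S (extend p) by [].
by apply: (mulIf n0); rewrite rE density_mul.
Qed.

Lemma zero_density_small (d : nat) (act : 'rV[int]_d -> L -> L) o mu nu :
  transitive_action act -> zero_entropy_density act o mu nu ->
  forall e N, 0 < e -> exists2 n, (N <= n)%N &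
     cyl_dominated mu nu (cube act o n) /\
     entropy mu nu (cube act o n) < e * #|` cube act o n|%:R.
Proof.
move=> aa /fine_cvgP[fin h] e N e0.
have /cvgrPdist_lt /(_ _ e0) small := h.
have [n _ hn] := filterI fin small.
pose m := (n + N)%N; exists m; first exact: leq_addl.
have c0 : (0 : R) < #|` cube act o m|%:R.
  rewrite ltr0n cardfs_gt0; apply/fset0Pn; exists o; exact: cube_center.
have [fm sm] := hn m (leq_addr _ _).
have rn : rel_entropy (cube act o m) mu nu != +oo%E.
  apply/eqP => rE; move: fm; rewrite rE mulyr gtr0_sg ?invr_gt0 //.
  by rewrite mul1e.
have [dom rE] := rel_entropyE rn; split => //.
move: sm; rewrite /= rE /= sub0r normrN ger0_norm; last first.
  by rewrite mulr_ge0 ?entropy_ge0 ?invr_ge0 ?ltW.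
by rewrite ltr_pdivrMr.
Qed.

End RelativeEntropy.

(** * Measures of zero entropy density *)

Lemma prob1_setI (R : realType) (d : measure_display) (T : measurableType d)
    (mu : probability T R) (A B : set T) :
  measurable A -> measurable B -> mu A = 1%E -> mu B = 1%E ->
  mu (A `&` B) = 1%E.
Proof.
move=> mA mB A1 B1.
have -> : A `&` B = \bigcap_(i : bool) (if i then A else B).
  by apply/seteqP; split=> [x [Ax Bx] [] _ //|x h]; split;
    [exact: (h true)|exact: (h false)].
by apply: prob1_bigcapT => -[].
Qed.

Section Final.
Context (R : realType) (d : nat) (L : countType) (act : 'rV[int]_d -> L -> L)
  (o : L) (disp : Order.disp_t) (E : finTBOrderType disp).
Notation Omega := (config L E).
Notation totally := summability.totally.
Implicit Types (b c : bool) (S T V W D Lam : {fset L}) (w s : Omega)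
  (f h v : Omega -> R).

Hypothesis act_action : transitive_action act.
Variable g : kernel_family R L E.
Hypothesis gs : is_specification g.
Hypothesis gm : monotonicity_preserving g.
Hypothesis ginv : invariant_spec act g.
Variable gl : bool -> kernel_family R L E.
Hypothesis glE : forall b, boundary_limit g (extreme b) (gl b).

Section Invariant.
Variables (mu nu : probability Omega R) (b : bool).
Hypothesis nuE : volume_limit g (extreme b) nu.
Hypothesis mu_inv : invariant_measure act mu.
Hypothesis zero : zero_entropy_density act o mu nu.

(** The key consequence of zero entropy density: [mu] is nearly the measure that
    draws the spins in [D] from [mu] and those in [Lam], given them, from [nu],
    for suitable arbitrarily large [D] disjoint from [Lam]. *)
Lemma density_approx Lam S f (e : R) : local_fun f -> 0 < e -> exists D,
  [/\ [disjoint D & Lam]%fset, (S `\` Lam `<=` D)%fset, cyl_dominated mu nu D &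
   `|\int[mu]_s f s - \int[nu]_s (density mu nu D s * f s)| <= e].
Proof.
move=> lf e0; have [T dT] := lf; have [_ [M hM]] := local_bm lf.
have M0 : 0 <= M by apply: le_trans (hM (extreme b)).
(* With a gap of at most [2 * t * t] the error is at most [M * (3 * t)]. *)
pose t := e / (4 * (M + 1)).
have M1 : 0 < M + 1 by rewrite ltr_wpDl.
have t0 : 0 < t by rewrite divr_gt0 // mulr_gt0.
have nu_inv := volume_limit_invariant act_action ginv nuE.
have [|W [STW LW dom small]] := small_entropy_gap act_action mu_inv nu_inv
  (zero_density_small act_action zero) (S `|` T)%fset Lam (delta := 2 * t * t).
  by apply: mulr_gt0 => //; apply: mulr_gt0.
have WW : (W `\` Lam `<=` W)%fset by exact: fsubsetDl.
exists (W `\` Lam)%fset; split.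
- by apply/fdisjointP => x; rewrite inE => /andP[].
- apply/fsubsetP => x; rewrite !inE => /andP[-> xS] /=.
  by apply: (fsubsetP STW); rewrite inE xS.
- exact: dominatedS WW dom.
have dW : depends_on [set` W] f.
  by move=> w s ws; apply: dT => x xT; apply: ws;
    apply: (fsubsetP STW); rewrite inE xT orbT.
apply: le_trans (entropy_estimate WW dom dW t0 hM) _.
have h : (entropy mu nu W - entropy mu nu (W `\` Lam)%fset) / (2 * t) <= t.
  rewrite ler_pdivrMr; first by rewrite [leRHS]mulrC; apply: ltW.
  by apply: mulr_gt0.
apply: (@le_trans _ _ ((M + 1) * (t + t * 2))).
  have h0 : 0 <= (entropy mu nu W - entropy mu nu (W `\` Lam)%fset) / (2 * t).
    apply: divr_ge0; first by rewrite subr_ge0; apply: entropy_le.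
    by apply: mulr_ge0 => //; apply: ltW.
  have t2 : 0 <= t * 2 by rewrite mulr_ge0 // ltW.
  apply: ler_pM; [exact: M0|exact: addr_ge0|by rewrite lerDl|by rewrite lerD2r].
have -> : (M + 1) * (t + t * 2) = e * (3 / 4).
  by rewrite /t; field; rewrite gt_eqF.
by rewrite ler_piMr ?ltW //; lra.
Qed.

(** Integrated against the density of [mu], the frozen function has the same
    average under [nu] as under [mu], since it only depends on spins in [D]. *)
Lemma avg_le_frozen_limit c Lam S f : local_fun f -> monotone c f ->
  \int[mu]_s f s <= \int[mu]_s frozen g c Lam f S s.
Proof.
move=> lf mf; apply/ler_addgt0Pr => e e0.
have [D [DL SD dom approx]] := density_approx Lam S lf e0.
have h := avg_le_frozen gs gm S nuE (@density_depends _ _ _ _ mu nu D) DL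
  (density_ge0 mu nu D) lf mf.
have db : depends_on [set` D] (frozen g c Lam f S).
  have := @frozen_depends _ _ _ _ g gs c Lam f S.
  by apply: dependsS => x; exact: (fsubsetP SD).
rewrite (avg_density dom db) in h.
by move: approx; rewrite ler_norml => /andP[_]; lra.
Qed.

Lemma avg_le_limit c Lam f : local_fun f -> monotone c f ->
  \int[mu]_s f s <= \int[mu]_s kapp (gl c) Lam f s.
Proof.
move=> lf mf; have [_ h] := avg_frozen_exhaustion (@glE c) mu Lam lf.
by apply: (cvgr_to_ge h); apply: nearW => n; apply: avg_le_frozen_limit.
Qed.

(** The averages of the two limit kernels enclose that of a monotone [f], and they
    coincide when the two kernels agree almost surely. *)
Lemma Omega_pm_gibbs : mu (Omega_pm (gl true) (gl false)) = 1%E ->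
  forall c, gibbs (gl c) mu.
Proof.
move=> pm1 c Lam.
have bk c' Lam' f : local_fun f -> bounded_measurable (kapp (gl c') Lam' f).
  by move=> lf; apply: (bm_kapp_limit (@glE c')).
have mpm := measurable_Omega_pm (bk true) (bk false).
apply: mixture_eq => [A mA|f].
  exact: (limit_kernel_measurable gs (@glE c)).
move: f; apply: (local_monotone_ind (b := c)) => [f lf mf|f h lf lh IHf IHh]; last first.
  rewrite avg_sub //; try exact: local_bm.
  rewrite -IHf -IHh -avg_sub; try exact: bk.
  by apply: eq_Rintegral => s _; rewrite avg_sub //; exact: local_bm.
apply/eqP; rewrite eq_le avg_le_limit // andbT.
have eqpm : \int[mu]_s kapp (gl c) Lam f s = \int[mu]_s kapp (gl (~~ c)) Lam f s.
  apply: (avg_ae mpm pm1); try exact: bk.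
  by move=> s /(_ Lam f lf); case: (c).
rewrite -/(kapp (gl c) Lam f) [leLHS]eqpm.
have lf' : local_fun (fun w => - f w) by apply: local_comp.
have := avg_le_limit Lam lf' (monotoneN mf).
rewrite avg_opp; last exact: local_bm.
rewrite (_ : \int[mu]_s kapp _ Lam _ s = - \int[mu]_s kapp (gl (~~ c)) Lam f s).
  by rewrite lerN2.
rewrite -avg_opp; last exact: bk.
by apply: eq_Rintegral => s _; rewrite /kapp avg_opp //; exact: local_bm.
Qed.

Lemma Omega_pm_quasilocal c : mu (Omega_pm (gl true) (gl false)) = 1%E ->
  mu (continuity_set (gl c)) = 1%E.
Proof.
move=> pm1.
have bk c' Lam' f : local_fun f -> bounded_measurable (kapp (gl c') Lam' f).
  by move=> lf; apply: (bm_kapp_limit (@glE c')).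
apply: prob1_subset pm1.
- exact: measurable_Omega_pm (bk true) (bk false).
- exact: measurable_continuity_set.
- exact: (Omega_pm_continuity gm glE (b := true)).
Qed.

Lemma Omega_pm_almost_quasilocal : mu (Omega_pm (gl true) (gl false)) = 1%E ->
  gibbs (gl b) mu /\ almost_quasilocal mu.
Proof.
move=> pm1; have gb := Omega_pm_gibbs pm1; split=> //; exists (gl b); split=> //.
  exact: (limit_specification gs gm (@glE b)).
exact: Omega_pm_quasilocal.
Qed.

End Invariant.

Section Opposite.
Variables (mu nu : probability Omega R) (b : bool).
Hypothesis muE : volume_limit g (extreme (~~ b)) mu.
Hypothesis nuE : volume_limit g (extreme b) nu.
Hypothesis zero : zero_entropy_density act o mu nu.

(** The reverse of [avg_le_limit]. The density of [mu] times [nu] dominates [mu],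
    as [nu] is the limit for the larger boundary condition; tested on the frozen
    functions, whose averages converge to that of [f], this bounds the average of
    the limit kernel from above. *)
Lemma limit_le_avg Lam f : local_fun f -> monotone b f ->
  \int[mu]_s kapp (gl b) Lam f s <= \int[mu]_s f s.
Proof.
move=> lf mf; apply/ler_addgt0Pr => e e0.
have mu_inv := volume_limit_invariant act_action ginv muE.
have [D [DL _ dom approx]] := density_approx nuE mu_inv zero Lam fset0 lf e0.
have h : \int[mu]_s kapp (gl b) Lam f s <= \int[nu]_s (density mu nu D s * f s).
  have c := avg_frozen_cvg gs gm nuE (@density_depends _ _ _ _ mu nu D) DL lf.
  apply: (totally_ge_cst (T := fset0) c) => S _.
  have lb := @local_frozen R L disp E g b Lam f S.
  have mb : monotone b (frozen g b Lam f S).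
    by apply: (frozen_monotone gm) => //; exact: local_bm.
  apply: le_trans (avg_le_density gs gm muE nuE dom lb mb).
  apply: avg_le; first exact: (bm_kapp_limit (@glE b)).
    exact: bm_frozen.
  by move=> s; apply: (limit_le_frozen gm (@glE b)).
by move: approx; rewrite ler_norml => /andP[+ _]; lra.
Qed.

(** [mu] is Gibbs for its own limit specification, so that both limit kernels
    give [f] the same average; being ordered, they agree almost surely. *)
Lemma opposite_Omega_pm : mu (Omega_pm (gl true) (gl false)) = 1%E.
Proof.
have bk c' Lam' f : local_fun f -> bounded_measurable (kapp (gl c') Lam' f).
  by move=> lf; apply: (bm_kapp_limit (@glE c')).
have mono Lam f : local_fun f -> monotone b f ->
    mu [set w | kapp (gl true) Lam f w - kapp (gl false) Lam f w = 0] = 1%E.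
  move=> lf mf.
  have gib := volume_limit_gibbs gs gm (@glE (~~ b)) muE.
  have e1 : \int[mu]_s kapp (gl (~~ b)) Lam f s = \int[mu]_s f s.
    apply: avg_gibbs => // A mA; first exact: (limit_kernel_measurable gs (@glE (~~ b))).
    exact: gib.
  have : mu [set w | kapp (gl b) Lam f w - kapp (gl (~~ b)) Lam f w = 0] = 1%E.
    apply: avg_eq0; first by apply: bm_sub; exact: bk.
      by move=> s; rewrite subr_ge0; apply: (limit_ordered gm glE).
    rewrite avg_sub; try exact: bk.
    apply/eqP; rewrite eq_le subr_le0 subr_ge0 {1}e1 limit_le_avg //=.
    apply: avg_le; try exact: bk.
    by move=> s; apply: (limit_ordered gm glE).
  move=> <-; congr (mu _); apply/seteqP.
  case: (b); split=> w //= /eqP; rewrite subr_eq0 => /eqP ->; exact: subrr.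
apply: Omega_pm_full => // [Lam f lf|Lam f lf|Lam f lf]; try exact: bk.
have [f1 [f2 [l1 l2 m1 m2 fE]]] := local_monotone_sub b lf.
pose Z f' := [set w | kapp (gl true) Lam f' w - kapp (gl false) Lam f' w = 0].
have mZ f' : local_fun f' -> measurable (Z f').
  exact: measurable_kapp_eq (bk true) (bk false) Lam _.
apply: (@prob1_subset _ _ _ _ (Z f1 `&` Z f2)).
- by apply: measurableI; apply: mZ.
- exact: mZ.
- move=> w [/= z1 z2]; rewrite (_ : f = fun w => f1 w - f2 w); last exact/funext.
  have kB c : kapp (gl c) Lam (fun s => f1 s - f2 s) w =
      kapp (gl c) Lam f1 w - kapp (gl c) Lam f2 w.
    by apply: avg_sub; exact: local_bm.
  by rewrite /= !kB (subr0_eq z1) (subr0_eq z2) subrr.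
- by apply: prob1_setI; [exact: mZ|exact: mZ|exact: mono|exact: mono].
Qed.

End Opposite.
End Final.

(** * Zero entropy density and almost quasilocality *)

Theorem corollary5 (R : realType) (d : nat) (L : countType)
    (act : 'rV[int]_d -> L -> L) (o : L)
    (disp : Order.disp_t) (E : finTBOrderType disp)
    (gamma gammap gammam : kernel_family R L E)
    (mup mum : probability (config L E) R)
    (act_action : transitive_action act)
    (gamma_spec : is_specification gamma)
    (gamma_mono : monotonicity_preserving gamma)
    (gamma_inv : invariant_spec act gamma)
    (gammapE : boundary_limit gamma (cst \top%O) gammap)
    (gammamE : boundary_limit gamma (cst \bot%O) gammam)
    (mupE : volume_limit gamma (cst \top%O) mup)
    (mumE : volume_limit gamma (cst \bot%O) mum) :
  [/\ (zero_entropy_density act o mum mup ->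
        [/\ gibbs gammap mum,
            mum (continuity_set gammap) = 1%E,
            mum (continuity_set gammam) = 1%E &
            almost_quasilocal mum]),
      (forall mu : probability (config L E) R,
        invariant_measure act mu ->
        zero_entropy_density act o mu mup ->
        mu (Omega_pm gammap gammam) = 1%E ->
        gibbs gammap mu /\ almost_quasilocal mu),
      (zero_entropy_density act o mup mum ->
        [/\ gibbs gammam mup,
            mup (continuity_set gammap) = 1%E,
            mup (continuity_set gammam) = 1%E &
            almost_quasilocal mup]) &
      (forall mu : probability (config L E) R,
        invariant_measure act mu ->
        zero_entropy_density act o mu mum ->
        mu (Omega_pm gammap gammam) = 1%E ->
        gibbs gammam mu /\ almost_quasilocal mu)].
Proof.
pose gl b := if b then gammap else gammam.
have glE b : boundary_limit gamma (extreme b) (gl b) by case: b.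
pose lim b := if b then mup else mum.
have limE b : volume_limit gamma (extreme b) (lim b) by case: b.
have part_b b mu : invariant_measure act mu ->
    zero_entropy_density act o mu (lim b) ->
    mu (Omega_pm gammap gammam) = 1%E -> gibbs (gl b) mu /\ almost_quasilocal mu.
  move=> inv zero; exact: (Omega_pm_almost_quasilocal act_action gamma_spec
    gamma_mono gamma_inv glE (limE b) inv zero).
have part_a b : zero_entropy_density act o (lim (~~ b)) (lim b) ->
    [/\ gibbs (gl b) (lim (~~ b)),
        lim (~~ b) (continuity_set gammap) = 1%E,
        lim (~~ b) (continuity_set gammam) = 1%E &
        almost_quasilocal (lim (~~ b))].
  move=> zero.
  have pm1 : lim (~~ b) (Omega_pm gammap gammam) = 1%E :=
    opposite_Omega_pm act_action gamma_spec gamma_mono gamma_inv glE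
      (limE (~~ b)) (limE b) zero.
  have inv := volume_limit_invariant act_action gamma_inv (limE (~~ b)).
  have [gib aql] := part_b b _ inv zero pm1; split => //.
    exact: (Omega_pm_quasilocal gamma_mono glE true pm1).
  exact: (Omega_pm_quasilocal gamma_mono glE false pm1).
split; [exact: (part_a true)|exact: (part_b true)|
        exact: (part_a false)|exact: (part_b false)].
Qed.
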